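(* Consider a structurally well-posed DAE $f_1=\dots=f_n=0$ in variables $x_1(t),\dots,x_n(t)$ with signature matrix $\mathbf\Sigma=(\sigma_{ij})$, a valid offset pair $(\mathbf c;\mathbf d)$ of $\mathbf\Sigma$ and corresponding System Jacobian $\mathbf J$, with equations and variables ordered so that the Jacobian sparsity pattern $\mathbf S_0=\{(i,j)\mid d_j-c_i=\sigma_{ij}\}$ is in a $p\times p$ block triangular form with diagonal blocks of sizes $N_1,\dots,N_p$ and index sets $B_1,\dots,B_p$. Suppose that for some $q\in\{1,\dots,p\}$ the diagonal block $\mathbf J_{qq}$ of $\mathbf J$ is identically singular. Let $\widehat{\mathbf v}\not\equiv\mathbf 0$ be an $N_q$-vector in $\ker(\mathbf J_{qq})$, and let $\mathbf v=(v_1,\dots,v_n)^T$ be the $n$-vector whose entries with indices in $B_q$ form $\widehat{\mathbf v}$ and whose other entries are $0$. Put $$J=\{j\mid v_j\not\equiv0\}\subseteq B_q,\quad s=|J|,\quad M=\{i\in B_q\mid d_j-c_i=\sigma_{ij}\text{ for some }j\in J\},\quad \overline c=\max_{i\in M}c_i .$$ Assume that $$\sigma(x_j,\mathbf v)\begin{cases}<d_j-\overline c&\text{if } j\in J\text{ or }\mathrm{blockOf}(j)<q,\\ \le d_j-\overline c&\text{if } j\in B_q\setminus J\text{ or }\mathrm{blockOf}(j)>q,\end{cases}\qquad\text{and}\qquad d_j-\overline c\ge0\ \text{ for all } j\in J .$$ For an $l\in J$, if we 1) introduce $s-1$ new variables $$y_j=x_j^{(d_j-\overline c)}-\frac{v_j}{v_l}\,x_l^{(d_l-\overline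 c)},\qquad j\in J\setminus\{l\};$$ 2) in each $f_i$ with $i\in B_q$, replace each $x_j^{(\sigma_{ij})}$ with $d_j-c_i=\sigma_{ij}$ and $j\in J\setminus\{l\}$ by $$\Bigl(y_j+\frac{v_j}{v_l}\,x_l^{(d_l-\overline c)}\Bigr)^{(\overline c-c_i)};$$ 3) append the $s-1$ equations $$0=g_j=-y_j+x_j^{(d_j-\overline c)}-\frac{v_j}{v_l}\,x_l^{(d_l-\overline c)},\qquad j\in J\setminus\{l\},$$ then $\mathrm{Val}(\overline{\mathbf\Sigma})<\mathrm{Val}(\mathbf\Sigma)$, where $\overline{\mathbf\Sigma}$ is the signature matrix of the resulting DAE (of $n+s-1$ equations in the $n+s-1$ variables $x_1,\dots,x_n$ and $y_j$, $j\in J\setminus\{l\}$).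
   Context: A DAE here is a system $f_i(t,\text{ the }x_j\text{ and derivatives of them})=0$, $i=1,\dots,n$, in $n$ state variables $x_j(t)$, with $f_i$ sufficiently smooth (say analytic on a connected domain); where one divides by $v_l$ one works where $v_l\ne0$. ''$\equiv 0$'' means identically zero as a function of $t$ and the variables and their derivatives regarded as independent variables; $f^{(k)}$ is the $k$-th total derivative with respect to $t$. ''Derivatives'' of a variable include the variable itself (order $0$). For an expression (or a vector of expressions) $u$ in $t$ and the derivatives of the variables, $\sigma(x_j,u)$ is the order of the highest derivative of $x_j$ that occurs in $u$ (i.e. on which $u$ genuinely depends), or $-\infty$ if $x_j$ does not occur. The signature matrix is $\mathbf\Sigma=(\sigma_{ij})$ with $\sigma_{ij}=\sigma(x_j,f_i)$ (and analogously for any DAE). A transversal of a square matrix of size $m$ is a set of $m$ positions with exactly one in each row and each column; $\mathrm{Val}(\mathbf\Sigma)$ is the maximum over all transversals $T$ of $\sum_{(i,j)\in T}\sigma_{ij}$, and a maximizing transversal is a highest-value transversal (HVT). The DAE is structurally well posed if $\mathrm{Val}(\mathbf\Sigma)$ is finite. A valid offset pair $(\mathbf c;\mathbf d)$ consists of integer $n$-vectors with $c_i\ge 0$ and $d_j-c_i\ge\sigma_{ij}$ for all $i,j$, with equality on an HVT (hence on every HVT). The System Jacobian $\mathbf J=(J_{ij})$ has $J_{ij}=\partial f_i/\partial x_j^{(\sigma_{ij})}$ if $d_j-c_i=\sigma_{ij}$ and $J_{ij}=0$ otherwise. A sparsity pattern $\mathbf A\subseteq\{1,\dots,n\}^2$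 is in a $p\times p$ block triangular form (BTF) with block sizes $N_1,\dots,N_p\ge 1$, $\sum N_q=n$, if, with $B_q=\{N_1+\dots+N_{q-1}+1,\dots,N_1+\dots+N_q\}$, there is no $(i,j)\in\mathbf A$ with $i\in B_k$, $j\in B_m$, $k>m$. $\mathrm{blockOf}(i)=q$ means $i\in B_q$. $\mathbf J_{qq}$ is the $q$-th diagonal block of $\mathbf J$ (rows and columns in $B_q$). $\ker(\mathbf J_{qq})$ is the set of vectors $\widehat{\mathbf v}$ of expressions with $\mathbf J_{qq}\widehat{\mathbf v}\equiv\mathbf 0$. A square matrix of expressions is identically singular if its determinant is $\equiv0$.
   Formalization: The resulting DAE is taken where v_l≠0 and the points before and after the replacement lie in one connected part of the slice of the domain with unreplaced derivatives fixed (automatic for convex domains); otherwise v may change under the replacement and the claim can fail. *)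

(* Defs.v *)
From HB Require Import structures.
From mathcomp Require Import all_boot all_order all_fingroup all_algebra.
From mathcomp Require Import all_classical all_reals all_analysis.

Set Implicit Arguments.
Unset Strict Implicit.
Unset Printing Implicit Defensive.

Import Order.TTheory GRing.Theory Num.Theory.
Import numFieldNormedType.Exports.
Local Open Scope classical_set_scope.
Local Open Scope ring_scope.

(** * Differential expressions

   The independent variables of an expression are [None], standing for the
   time [t], and [Some (j, k)], standing for the derivative [x_j^(k)].  Points
   assign a value to each of them, with the topology of pointwise convergence;
   finiteness of the order of expressions is imposed separately. *)

Definition coord (V : finType) := option (V * nat).

Definition jet (R : realType) (V : finType) := {ptws coord V -> R}.

Definition expr (R : realType) (V : finType) := jet R V -> R.

Section Expressions.
Context {R : realType} {V : finType}.
Implicit Types (D : set (jet R V)) (u : expr R V) (P Q : jet R V).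

Definition agree_upto (K : nat) P Q :=
  P None = Q None /\
  forall j k, (k <= K)%N -> P (Some (j, k)) = Q (Some (j, k)).

Definition jet_domain D :=
  [/\ open D, connected D &
      exists K, forall P Q, agree_upto K P Q -> D P -> D Q].

Definition upd P (a : coord V) (h : R) : jet R V :=
  fun b => if b == a then h else P b.

(** The partial derivative of [u] with respect to the variable [a]. *)
Definition pd (a : coord V) u : expr R V :=
  fun P => derive1 (fun h => u (upd P a h)) (P a).

(** An expression on [D] is a total function of which only the values on [D]
   matter; smooth means C^oo as a function of finitely many variables. *)
Definition finite_order D u :=
  exists K, forall P Q, D P -> D Q -> agree_upto K P Q -> u P = u Q.

Definition smooth_expr D u :=
  finite_order D u /\
  forall (s : seq (coord V)) P, D P ->
    let w := foldr pd u s in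
    {for P, continuous w} /\
    forall a, derivable (fun h => w (upd P a h) : R) (P a) 1.

(** The total derivative [d/dt].  The sum over [k] is one of finite support
   when [u] has finite order. *)
Definition Dt u : expr R V := fun P =>
  pd None u P +
  \sum_(j : V) \sum_(k \in [set: nat]) pd (Some (j, k)) u P * P (Some (j, k.+1)).

Definition nonzero_on D u := exists P, D P /\ u P <> 0.

Definition occurs D j k u := nonzero_on D (pd (Some (j, k)) u).

(** [ereal_sup set0 = -oo]. *)
Definition sigma D j u : \bar R :=
  ereal_sup [set (k%:R)%:E | k in [set k | occurs D j k u]].

Definition sigma_vec (I : finType) D j (u : I -> expr R V) : \bar R :=
  \big[Order.max/-oo%E]_(i : I) sigma D j (u i).

End Expressions.

(** * Signature matrices

   Equations and variables are both indexed by the finite type [I]; the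
   transversals are the permutations [s], with positions [(i, s i)]. *)

Section Signature.
Context {R : realType} {I : finType}.

Definition signature (D : set (jet R I)) (f : I -> expr R I) : I -> I -> \bar R :=
  fun i j => sigma D j (f i).

Implicit Types (S : I -> I -> \bar R) (c d : I -> int).

Definition transversal_value S (s : {perm I}) : \bar R := (\sum_i S i (s i))%E.

Definition Val S : \bar R := \big[Order.max/-oo%E]_(s : {perm I}) transversal_value S s.

Definition is_HVT S (s : {perm I}) := transversal_value S s = Val S.

Definition structurally_well_posed S := Val S \is a fin_num.

Definition valid_offsets S c d :=
  [/\ forall i, 0 <= c i,
      forall i j, (S i j <= ((d j - c i)%:~R)%:E)%E &
      exists2 s, is_HVT S s & forall i, S i (s i) = ((d (s i) - c i)%:~R)%:E].

(** The sparsity pattern [S_0] of the System Jacobian. *)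
Definition pattern S c d : rel I := fun i j => `[< ((d j - c i)%:~R)%:E = S i j >].

(** Where the pattern holds, the natural number [sigma_ij] is
   [absz (d j - c i)]. *)
Definition system_jacobian (D : set (jet R I)) (f : I -> expr R I) c d i j : expr R I :=
  if pattern (signature D f) c d i j then pd (Some (j, absz (d j - c i))) (f i)
  else fun=> 0.

End Signature.

(** * Block triangular forms

   The indices [0, ..., n - 1], with [n = \sum_k N k], are grouped into
   consecutive blocks of sizes [N 0, ..., N (p - 1)]. *)

Section Blocks.
Context {p : nat} {N : 'I_p -> nat}.
Local Notation n := (\sum_k N k)%N.

Definition blockOf (i : 'I_n) : 'I_p := tagnat.sig1 i.

Definition block (q : 'I_p) : {set 'I_n} := [set i | blockOf i == q]%SET.

Definition in_BTF (A : rel 'I_n) :=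
  (forall k, 0 < N k)%N /\ forall i j, A i j -> ~ (blockOf j < blockOf i)%N.

Context {R : realType}.

Definition diagonal_block (D : set (jet R 'I_n)) (f : 'I_n -> expr R 'I_n)
    (c d : 'I_n -> int) (q : 'I_p) (P : jet R 'I_n) : 'M[R]_(N q) :=
  submxblock (\matrix_(i, j) system_jacobian D f c d i j P) q q.

Definition identically_singular m (D : set (jet R 'I_n)) (A : jet R 'I_n -> 'M[R]_m) :=
  forall P, D P -> \det (A P) = 0.

Definition in_kernel m (D : set (jet R 'I_n)) (A : jet R 'I_n -> 'M[R]_m)
    (w : 'I_m -> expr R 'I_n) :=
  forall P, D P -> A P *m (\col_a w a P) = 0.

(** The [n]-vector with entries [w] in the block [q] and [0] elsewhere. *)
Definition extend_by_zero (q : 'I_p) (w : 'I_(N q) -> expr R 'I_n) :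
    'I_n -> expr R 'I_n :=
  fun i => if [pick a | tagnat.Rank q a == i] is Some a then w a else fun=> 0.

End Blocks.

(** * The conversion

   [B] is the set of indices of the block and [v] the kernel vector. *)

Section Conversion.
Context {R : realType} {I : finType}.
Variables (D : set (jet R I)) (f : I -> expr R I) (c d : I -> int).
Variables (B : {set I}) (v : I -> expr R I).

Definition Jset : {set I} := [set j | `[< nonzero_on D (v j) >]]%SET.

Definition Mset : {set I} :=
  [set i in B | [exists j in Jset, pattern (signature D f) c d i j]]%SET.

(** The default value [0] of the maximum is harmless as offsets [c] are
   nonnegative. *)
Definition cbar : int := \big[Order.max/0]_(i in Mset) c i.

Variable l : I.

(** The variables of the new system: [inl j] is [x_j] and [inr j] is [y_j].
   The same type indexes its equations: [inl i] for the modified [f_i] and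
   [inr j] for [g_j]. *)
Definition newI : finType := (I + {j : I | j \in Jset :\ l})%type.

Definition old_part (P : jet R newI) : jet R I := fun a =>
  match a with
  | None => P None
  | Some (j, k) => P (Some (inl j, k))
  end.

Definition ratio (j : I) : expr R newI := fun P => v j (old_part P) / v l (old_part P).

Definition xder (j : I) : expr R newI := fun P => P (Some (inl j, absz (d j - cbar))).

Definition yexpr (j : {j : I | j \in Jset :\ l}) : expr R newI := fun P =>
  P (Some (inr j, 0%N)) + ratio (val j) P * xder l P.

Definition replaced (i : I) (a : coord I) : bool :=
  match a with
  | None => false
  | Some (j, k) =>
    [&& j \in Jset :\ l, pattern (signature D f) c d i j & k == absz (d j - c i)]
  end.

(** The values of [t] and of the [x_j^(k)] that are fed into [f_i], [i] in [B],
   after the replacement.  The order [cbar - c i] is nonnegative whenever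
   something is replaced, as then [i] is in [Mset]. *)
Definition substituted (i : I) (P : jet R newI) : jet R I := fun a =>
  match a with
  | None => P None
  | Some (j, k) =>
    if insub j is Some j' then
      if replaced i (Some (j, k)) then iter (absz (cbar - c i)) Dt (yexpr j') P
      else P (Some (inl j, k))
    else P (Some (inl j, k))
  end.

Definition new_dae (i : newI) : expr R newI :=
  match i with
  | inl i => fun P => f i (if i \in B then substituted i P else old_part P)
  | inr j => fun P => - P (Some (inr j, 0%N)) + xder (val j) P - ratio (val j) P * xder l P
  end.

(** The new system lives where [v_l <> 0] and the substituted values are in
   [D].  As [D] is an arbitrary connected open set, a function on [D] whose
   partial derivatives in the replaced variables vanish, such as [v], need not
   take the same value at two points of [D] that differ in those variables
   only; it does if these points are in the same connected component of the
   corresponding slice of [D], which is what is asked of the points before and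
   after substitution.  When [D] is convex, so are its slices, and this reduces
   to both points being in [D]. *)
Definition new_domain : set (jet R newI) := [set P |
  [/\ D (old_part P), v l (old_part P) <> 0 &
      forall i, i \in B -> exists C : set (jet R I),
        [/\ connected C, C `<=` D, C (old_part P), C (substituted i P) &
            forall Q, C Q -> forall a, ~~ replaced i a -> Q a = old_part P a]]].

End Conversion.

Arguments new_dae {R I} D f c d B v l i P.
Arguments new_domain {R I} D f c d B v l P.

(* Main.v *)
(** Extend [c] by [cbar] on the equations [g_j] and [d] by [cbar] on the variables
    [y_j].  The orders of the new system are still bounded by [d - c] entrywise,
    and the sums of [d] and [c] still differ by [Val Sigma], so it suffices that
    no transversal consists of positions of equality only.  Equality in the column
    of [x_j] with [j] in an earlier block forces the row to be an [f_i] of an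
    earlier block; for [j] in [J] it forces the row to be such an [f_i] or some
    [g_j], because in the equations of [B_q] the leading derivatives of the [x_j],
    [j <> l], have been replaced while that of [x_l] now has the coefficient
    [(J_qq v)_i / v_l = 0].  There are [s] columns of the second kind but only
    [s - 1] rows [g_j]. *)
Require Import Defs.
From mathcomp Require Import all_boot all_order all_fingroup all_algebra.
From mathcomp Require Import all_classical all_reals all_analysis.
From mathcomp Require Import ring lra zify.
Import Order.TTheory GRing.Theory Num.Theory.
Import numFieldNormedType.Exports.
Local Open Scope classical_set_scope.
Local Open Scope ring_scope.

Set Implicit Arguments.
Unset Strict Implicit.

(** Because [cbar] is a maximum over the rows in which something can be replaced, the orders
    [cbar - c i] of differentiation are nonnegative there; differentiating [x_j^(d_j - cbar)] that
    often brings it back to order [d_j - c_i]. This is why one number serves as offset of both [g_j]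
    and [y_j]. The strict bounds on the orders of [v] act twice. They make [v_j / v_l] the
    coefficient of the leading derivative of [x_l] in the substituted expression, a coefficient that
    total differentiation preserves. They also resolve the obstacle to the cancellation: the chain
    rule evaluates the partial derivatives of [f_i] at the substituted point, while the quotients
    [v_j / v_l] are taken at the original one. The kernel identity concerns one point at a time, so
    [v] has to be carried from one point to the other. Orders are treated as integer bounds above
    which partial derivatives vanish; the value [-oo] appears only in the passage to and from
    signature matrices. *)

Local Notation coord := Defs.coord.

(** * Smooth expressions on open sets of jets *)

Section Boxes.
Context {R : realType} {V : finType}.
Implicit Types (P Q : jet R V) (a b : coord V) (s : seq (coord V)) (e h : R).

Definition box s e P : set (jet R V) := [set Q | forall a, a \in s -> `|Q a - P a| < e].

Lemma nbhs_boxP P (A : set (jet R V)) :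
  nbhs P A <-> exists s e, 0 < e /\ box s e P `<=` A.
Proof.
(* The boxes generate a filter; it converges to [P] in each coordinate, hence contains every
   neighbourhood of [P]. *)
pose F : set_system (jet R V) := [set A | exists s e, 0 < e /\ box s e P `<=` A].
have FF : Filter F.
  split.
  - by exists [::], 1; split.
  - move=> A1 A2 [s1 [e1 [e1p h1]]] [s2 [e2 [e2p h2]]].
    exists (s1 ++ s2), (Num.min e1 e2); split; first by rewrite lt_min e1p.
    move=> Q hQ; split; [apply: h1|apply: h2] => a ha.
      have := hQ a; rewrite mem_cat ha /= => /(_ isT).
      by rewrite lt_min => /andP[].
    have := hQ a; rewrite mem_cat ha orbT /= => /(_ isT).
    by rewrite lt_min => /andP[].
  - by move=> A1 A2 h12 [s [e [ep h]]]; exists s, e; split => // Q /h /h12.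
split.
  have : F --> P.
    apply/cvg_sup => a B [W [[U oU <-] UP] sub].
    have /nbhs_ballP[e /= ep hB] : nbhs (P a) U by exact: open_nbhs_nbhs.
    exists [:: a], e; split => // Q /(_ a); rewrite inE eqxx => /(_ isT) hQ.
    by apply: sub; apply: hB; rewrite /ball /= distrC.
  by apply.
move=> [s [e [ep h]]]; apply: filterS h _.
elim: s => [|a s ih].
  by rewrite (_ : box _ _ _ = setT) ?seteqP; [exact: filterT|split].
have /filterI : nbhs P [set Q : jet R V | `|Q a - P a| < e].
  apply: (@proj_continuous _ (fun=> R) a P [set x | `|x - P a| < e]).
  by apply/nbhs_ballP; exists e => //= x; rewrite /ball /= distrC.
move=> /(_ _ ih); apply: filterS => Q [h1 h2] b; rewrite inE => /predU1P[->//|/h2].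
exact.
Qed.

Lemma box_refl s e P : 0 < e -> box s e P P.
Proof. by move=> ep a _; rewrite subrr normr0. Qed.

Lemma box_sub s s' e e' P : {subset s' <= s} -> e <= e' -> box s e P `<=` box s' e' P.
Proof. by move=> ss ee Q h a /ss /h /lt_le_trans; apply. Qed.

Lemma box_upd s e P Q a h : box s e P Q -> `|h - P a| < e -> box s e P (upd Q a h).
Proof. by move=> hQ hh b /hQ; rewrite /upd; case: eqP => // ->. Qed.

Lemma upd_id P a : upd P a (P a) = P.
Proof. by apply/funext => b; rewrite /upd; case: eqP => // ->. Qed.

Lemma upd_upd P a h h' : upd (upd P a h) a h' = upd P a h'.
Proof. by apply/funext => b; rewrite /upd; case: eqP. Qed.

Lemma updC P a b h h' : a != b -> upd (upd P a h) b h' = upd (upd P b h') a h.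
Proof.
move=> ab; apply/funext => x; rewrite /upd.
by case: (x =P b) => [->|//]; rewrite eq_sym (negbTE ab).
Qed.

Lemma upd_same P a h : upd P a h a = h.
Proof. by rewrite /upd eqxx. Qed.

Lemma upd_diff P a b h : b != a -> upd P a h b = P b.
Proof. by rewrite /upd => /negbTE ->. Qed.

Lemma near_upd P a (A : set (jet R V)) : nbhs P A -> \forall h \near P a, A (upd P a h).
Proof.
move=> /nbhs_boxP[s [e [ep h]]]; apply/nbhs_ballP; exists e => //= x.
rewrite /ball /= distrC => xe; apply: h; apply: box_upd => //; exact: box_refl.
Qed.

Lemma open_box (D : set (jet R V)) P : open D -> D P ->
  exists s e, 0 < e /\ box s e P `<=` D.
Proof. by move=> oD DP; apply/nbhs_boxP; exact: open_nbhs_nbhs. Qed.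

Lemma near_open_upd (D : set (jet R V)) P a : open D -> D P -> \forall h \near P a, D (upd P a h).
Proof. by move=> oD DP; apply: near_upd; exact: open_nbhs_nbhs. Qed.

Lemma agree_upd K P Q a h : agree_upto K P Q -> agree_upto K (upd P a h) (upd Q a h).
Proof.
move=> [h0 h1]; split; first by rewrite /upd; case: eqP.
by move=> j k kK; rewrite /upd; case: eqP => // _; exact: h1.
Qed.

Lemma agree_uptoW K K' P Q : (K <= K')%N -> agree_upto K' P Q -> agree_upto K P Q.
Proof. by move=> KK [h0 h1]; split => // j k kK; apply: h1; exact: leq_trans KK. Qed.

End Boxes.

Section MeanValue.
Context {R : realType}.

(** No order between [x] and [y] is assumed: bounding the intermediate point by its distance to [x]
    keeps it in every box centred at [x] that contains [y]. *)
Lemma mvt_closed (g dg : R -> R) (x y : R) :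
  (forall z, `|z - x| <= `|y - x| -> is_derive z 1 g (dg z)) ->
  exists2 z, `|z - x| <= `|y - x| & g y - g x = dg z * (y - x).
Proof.
move=> hg; have [xy|/ltW yx] := leP x y.
  have inb z : x <= z <= y -> `|z - x| <= `|y - x|.
    by move=> /andP[xz zy]; rewrite !ger0_norm; lra.
  have [||z] := @MVT_segment R g dg x y xy.
  - by move=> z; rewrite in_itv /= => /andP[/ltW xz /ltW zy]; apply/hg/inb; rewrite xz.
  - apply: derivable_within_continuous => z; rewrite in_itv /= => /inb hz.
    by have [] := hg z hz.
  - by rewrite in_itv /= => /inb hz ez; exists z.
have inb z : y <= z <= x -> `|z - x| <= `|y - x|.
  by move=> /andP[yz zx]; rewrite !ler0_norm; lra.
have [||z] := @MVT_segment R g dg y x yx.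
- by move=> z; rewrite in_itv /= => /andP[/ltW yz /ltW zx]; apply/hg/inb; rewrite yz.
- apply: derivable_within_continuous => z; rewrite in_itv /= => /inb hz.
  by have [] := hg z hz.
- rewrite in_itv /= => /inb hz ez; exists z => //.
  by rewrite -opprB ez -mulrN opprB.
Qed.

End MeanValue.

(** * Iterated partial derivatives: sums, products, inverses *)

Section Smooth.
Context {R : realType} {V : finType}.
Implicit Types (P Q : jet R V) (a b : coord V) (u w : expr R V) (D : set (jet R V)).

Definition pdable D a u := forall P, D P ->
  is_derive (P a) 1 (fun h => u (upd P a h) : R) (pd a u P).

(** Counting differentiations, in place of listing the coordinates used, lets the closure properties
    go by induction on [n]. *)
Fixpoint Cn n D u : Prop :=
  (forall P, D P -> {for P, continuous u}) /\
  (if n is m.+1 then forall a, pdable D a u /\ Cn m D (pd a u) else True).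

Definition smooth D u := finite_order D u /\ forall n, Cn n D u.

Lemma pd_val a u P d : is_derive (P a) 1 (fun h => u (upd P a h) : R) d -> pd a u P = d.
Proof. by move=> h; rewrite /pd derive1E derive_val. Qed.

Lemma smooth_exprW D u : smooth_expr D u -> smooth D u.
Proof.
move=> [fo hs]; split => // n.
suff H : forall s, Cn n D (foldr pd u s) by exact: (H [::]).
elim: n => [|n ih] s; split => //=; try by move=> P DP; have [] := hs s P DP.
move=> a; split; last exact: (ih (a :: s)).
move=> P DP; have [_ /(_ a)] := hs s P DP.
by rewrite /pd derive1E => /derivableP.
Qed.

Lemma CnW n D u : Cn n.+1 D u -> Cn n D u.
Proof.
elim: n u => [|n ih] u; first by case.
by move=> [h1 h2]; split => // a; have [? /ih] := h2 a.
Qed.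

Lemma Cn_pdable n D u a : Cn n.+1 D u -> pdable D a u.
Proof. by move=> [_ /(_ a)[]]. Qed.

Lemma Cn_pd n D u a : Cn n.+1 D u -> Cn n D (pd a u).
Proof. by move=> [_ /(_ a)[]]. Qed.

Lemma Cn_cont n D u P : Cn n D u -> D P -> {for P, continuous u}.
Proof. by case: n => [|n] [h _]; exact: h. Qed.

Lemma eq_on_pd D a u w P : open D -> {in D, u =1 w} -> D P -> pd a u P = pd a w P.
Proof.
move=> oD uw DP; rewrite /pd !derive1E; apply: near_eq_derive.
by apply: filterS (near_open_upd a oD DP) => h hh; apply: uw; rewrite inE.
Qed.

Lemma eq_on_cont D u w P : open D -> {in D, u =1 w} -> D P ->
  {for P, continuous u} -> {for P, continuous w}.
Proof.
move=> oD uw DP; rewrite /prop_for /continuous_at (uw P) ?inE // => h A /h.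
apply: filterS2 (open_nbhs_nbhs (conj oD DP)) => Q DQ /=.
by rewrite uw // inE.
Qed.

Lemma eq_on_pdable D a u w : open D -> {in D, u =1 w} -> pdable D a u -> pdable D a w.
Proof.
move=> oD uw hu P DP; rewrite -(eq_on_pd _ oD uw DP).
apply: near_eq_is_derive (hu P DP).
by apply: filterS (near_open_upd a oD DP) => h hh; apply: uw; rewrite inE.
Qed.

(** The differentiation rules hold only at points of [D]; as [D] is open, equality there passes to
    all derivatives. *)
Lemma eq_on_Cn D n u w : open D -> {in D, u =1 w} -> Cn n D u -> Cn n D w.
Proof.
move=> oD; elim: n u w => [|n ih] u w uw.
  by move=> [h _]; split => // P DP; apply: eq_on_cont uw DP (h P DP).
move=> [h1 h2]; split; first by move=> P DP; apply: eq_on_cont uw DP (h1 P DP).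
move=> a; have [h3 h4] := h2 a; split; first exact: eq_on_pdable uw h3.
by apply: ih h4 => P; rewrite inE => DP; exact: (eq_on_pd a oD uw DP).
Qed.

Lemma is_derive_pd_cst a (r : R) P : is_derive (P a) 1 (fun h => (fun=> r) (upd P a h) : R) 0.
Proof. exact: (is_derive_cst (r : R)). Qed.

Lemma pd_cst a r : pd a (fun=> r) = (fun=> 0) :> expr R V.
Proof. by apply/funext => P; rewrite (@pd_val a _ P 0 (is_derive_pd_cst a r P)). Qed.

Lemma pdable_cst D a r : pdable D a (fun=> r).
Proof. by move=> P _; rewrite pd_cst; exact: is_derive_pd_cst. Qed.

Lemma Cn_cst n D r : Cn n D (fun=> r).
Proof.
elim: n r => [|n ih] r; split=> //; try by move=> P _; exact: cst_continuous.
by move=> a; split; [exact: pdable_cst|rewrite pd_cst].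
Qed.

Lemma is_derive_coord P a b :
  is_derive (P a) 1 (fun h => upd P a h b : R) ((b == a)%:R).
Proof.
rewrite /upd; case: eqP => _; first exact: is_derive_id.
exact: (is_derive_cst (P b : R)).
Qed.

Lemma pd_coord a b : pd a (fun P => P b) = (fun=> (b == a)%:R) :> expr R V.
Proof. by apply/funext => P; rewrite (@pd_val a _ P _ (is_derive_coord P a b)). Qed.

Lemma pdable_coord D a b : pdable D a (fun P => P b).
Proof. by move=> P _; rewrite pd_coord; exact: is_derive_coord. Qed.

Lemma cont_coord P b : {for P, continuous (fun Q : jet R V => Q b : R)}.
Proof. exact: (@proj_continuous _ (fun=> R) b P). Qed.

Lemma Cn_coord n D b : Cn n D (fun P => P b).
Proof.
case: n => [|n]; split => //; try by move=> P _; exact: cont_coord.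
by move=> a; split; [exact: pdable_coord|rewrite pd_coord; exact: Cn_cst].
Qed.

Lemma is_derive_add D a u w P : D P -> pdable D a u -> pdable D a w ->
  is_derive (P a) 1 (fun h => u (upd P a h) + w (upd P a h) : R) (pd a u P + pd a w P).
Proof. by move=> DP /(_ P DP) hu /(_ P DP) hw; exact: (is_deriveD hu hw). Qed.

Lemma pd_add D a u w P : D P -> pdable D a u -> pdable D a w ->
  pd a (fun P => u P + w P) P = pd a u P + pd a w P.
Proof. by move=> DP hu hw; rewrite (@pd_val a _ P _ (is_derive_add DP hu hw)). Qed.

Lemma Cn_add n D u w : open D -> Cn n D u -> Cn n D w -> Cn n D (fun P => u P + w P).
Proof.
move=> oD; elim: n u w => [|n ih] u w hu hw; split => //;
  try by move=> P DP; apply: (@continuousD _ _ _ u w); [exact: Cn_cont hu DP|exact: Cn_cont hw DP].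
move=> a; have [du dw] := (Cn_pdable a hu, Cn_pdable a hw); split.
  by move=> P DP; rewrite (pd_add DP du dw); exact: is_derive_add du dw.
apply: eq_on_Cn (ih _ _ (Cn_pd a hu) (Cn_pd a hw)) => //.
by move=> P; rewrite inE => DP; rewrite -(pd_add DP du dw).
Qed.

Lemma is_derive_mul D a u w P : D P -> pdable D a u -> pdable D a w ->
  is_derive (P a) 1 (fun h => u (upd P a h) * w (upd P a h) : R) (u P * pd a w P + w P * pd a u P).
Proof.
move=> DP /(_ P DP) hu /(_ P DP) hw; apply: is_derive_eq (is_deriveM hu hw) _.
by rewrite upd_id.
Qed.

Lemma pd_mul D a u w P : D P -> pdable D a u -> pdable D a w ->
  pd a (fun P => u P * w P) P = u P * pd a w P + w P * pd a u P.
Proof. by move=> DP hu hw; rewrite (@pd_val a _ P _ (is_derive_mul DP hu hw)). Qed.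

Lemma Cn_mul n D u w : open D -> Cn n D u -> Cn n D w -> Cn n D (fun P => u P * w P).
Proof.
move=> oD; elim: n u w => [|n ih] u w hu hw; split => //;
  try by move=> P DP; apply: (@continuousM _ _ u w); [exact: Cn_cont hu DP|exact: Cn_cont hw DP].
move=> a; have [du dw] := (Cn_pdable a hu, Cn_pdable a hw); split.
  by move=> P DP; rewrite (pd_mul DP du dw); exact: is_derive_mul du dw.
apply: eq_on_Cn (Cn_add oD (ih _ _ (CnW hu) (Cn_pd a hw)) (ih _ _ (CnW hw) (Cn_pd a hu))) => //.
by move=> P; rewrite inE => DP; rewrite -(pd_mul DP du dw).
Qed.

(** The derivative is written with constants, products and inverses only, the operations under which
    [Cn_inv] closes its induction. *)
Lemma is_derive_inv D a u P : D P -> (forall P, D P -> u P != 0) -> pdable D a u ->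
  is_derive (P a) 1 (fun h => (u (upd P a h))^-1 : R) (- 1 * (pd a u P * ((u P)^-1 * (u P)^-1))).
Proof.
move=> DP u0 /(_ P DP) hu.
have n0 : u (upd P a (P a)) != 0 by rewrite upd_id u0.
apply: is_derive_eq (is_deriveV n0 hu) _.
by rewrite upd_id /GRing.scale /= -exprVn expr2 mulN1r mulNr mulrC.
Qed.

Lemma pd_inv D a u P : D P -> (forall P, D P -> u P != 0) -> pdable D a u ->
  pd a (fun P => (u P)^-1) P = - 1 * (pd a u P * ((u P)^-1 * (u P)^-1)).
Proof. by move=> DP u0 hu; rewrite (@pd_val a _ P _ (is_derive_inv DP u0 hu)). Qed.

Lemma Cn_inv n D u : open D -> (forall P, D P -> u P != 0) -> Cn n D u ->
  Cn n D (fun P => (u P)^-1).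
Proof.
move=> oD u0; elim: n => [|n ih] hu; split => //;
  try by move=> P DP; apply: (@continuousV _ _ u); [exact: u0|exact: Cn_cont hu DP].
move=> a; have du := Cn_pdable a hu; split.
  by move=> P DP; rewrite (pd_inv DP u0 du); exact: is_derive_inv u0 du.
have iv := ih (CnW hu).
apply: eq_on_Cn (Cn_mul oD (Cn_cst n D (- 1)) (Cn_mul oD (Cn_pd a hu) (Cn_mul oD iv iv))) => //.
by move=> P; rewrite inE => DP; rewrite -(pd_inv DP u0 du).
Qed.

End Smooth.

(** * Finite order and total derivatives *)

Section SmoothClosure.
Context {R : realType} {V : finType}.
Implicit Types (P Q : jet R V) (a b : coord V) (s t : seq (coord V)) (u w : expr R V) (D : set (jet R V)).

Lemma smooth_pdable D u a : smooth D u -> pdable D a u.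
Proof. by move=> [_ /(_ 1%N) /Cn_pdable]. Qed.

Lemma smooth_cont D u P : smooth D u -> D P -> {for P, continuous u}.
Proof. by move=> [_ /(_ 0%N)] hu DP; exact: Cn_cont hu DP. Qed.

Lemma finite_order_pd D u a : open D -> finite_order D u -> finite_order D (pd a u).
Proof.
(* Agreement must include the coordinate [a] itself, so that both derivatives are taken at the same
   real number; hence the order [K + k]. *)
move=> oD [K hK]; pose k := if a is Some (_, k) then k else 0%N.
exists (K + k)%N => P Q DP DQ hPQ.
have ea : P a = Q a.
  case: hPQ => h0; move: @k; case: a => [[j k]|] //= hk; apply: hk.
  exact: leq_addl.
rewrite /pd !derive1E -ea; apply: near_eq_derive.
apply: filterS2 (near_open_upd a oD DP) _ => [h h1 h2|].
  apply: hK h1 h2 _; apply: agree_upd; apply: agree_uptoW hPQ; exact: leq_addr.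
by rewrite ea; exact: (near_open_upd a oD DQ).
Qed.

Lemma smooth_pd D u a : open D -> smooth D u -> smooth D (pd a u).
Proof.
move=> oD [fo hn]; split; first exact: finite_order_pd.
by move=> n; apply: Cn_pd; exact: hn.
Qed.

Lemma eq_on_smooth D u w : open D -> {in D, u =1 w} -> smooth D u -> smooth D w.
Proof.
move=> oD uw [[K hK] hn]; split; last by move=> n; apply: eq_on_Cn uw (hn n).
by exists K => P Q DP DQ /(hK P Q DP DQ); rewrite !uw ?inE.
Qed.

Lemma smooth_cst D r : smooth D (fun=> r).
Proof. by split; [exists 0%N|move=> n; exact: Cn_cst]. Qed.

Lemma smooth_coord D b : smooth D (fun P => P b).
Proof.
split; last by move=> n; exact: Cn_coord.
by case: b => [[j k]|]; [exists k|exists 0%N] => P Q _ _ [h0 h1] //; exact: h1.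
Qed.

Lemma finite_order2 D u w (F : R -> R -> R) : finite_order D u -> finite_order D w ->
  finite_order D (fun P => F (u P) (w P)).
Proof.
move=> [K hK] [K' hK']; exists (maxn K K') => P Q DP DQ h.
rewrite (hK P Q) ?(hK' P Q) //; apply: agree_uptoW h.
- exact: leq_maxr.
- exact: leq_maxl.
Qed.

Lemma smooth_add D u w : open D -> smooth D u -> smooth D w -> smooth D (fun P => u P + w P).
Proof.
by move=> oD [fu hu] [fw hw]; split; [exact: finite_order2|move=> n; exact: Cn_add].
Qed.

Lemma smooth_mul D u w : open D -> smooth D u -> smooth D w -> smooth D (fun P => u P * w P).
Proof.
by move=> oD [fu hu] [fw hw]; split; [exact: finite_order2|move=> n; exact: Cn_mul].
Qed.

Lemma smooth_inv D u : open D -> (forall P, D P -> u P != 0) -> smooth D u ->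
  smooth D (fun P => (u P)^-1).
Proof.
move=> oD u0 [fu hu]; split; last by move=> n; exact: Cn_inv.
exact: (@finite_order2 D u u (fun x _ => x^-1)).
Qed.

Lemma smooth_sum D (T : Type) (r : seq T) (F : T -> expr R V) : open D ->
  (forall i, smooth D (F i)) -> smooth D (fun P => \sum_(i <- r) F i P).
Proof.
move=> oD hF; elim: r => [|i r ih].
  by apply: eq_on_smooth (smooth_cst D 0) => // P _; rewrite big_nil.
by apply: eq_on_smooth (smooth_add oD (hF i) ih) => // P _; rewrite big_cons.
Qed.

Lemma DtE D u : open D -> finite_order D u -> exists K,
  (forall j k P, (K <= k)%N -> D P -> pd (Some (j, k)) u P = 0) /\
  (forall P, D P -> Dt u P = pd None u P +
    \sum_j \sum_(k < K) pd (Some (j, k : nat)) u P * P (Some (j, k.+1))).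
Proof.
move=> oD [K hK]; exists K.+1.
have h0 j k P : (K < k)%N -> D P -> pd (Some (j, k)) u P = 0.
  move=> Kk DP; rewrite /pd derive1E.
  rewrite -[RHS](derive1_cst (u P : R) (P (Some (j, k)))) derive1E.
  apply: near_eq_derive; apply: filterS (near_open_upd (Some (j, k)) oD DP) => h hh.
  apply: hK => //; split; first by rewrite upd_diff.
  move=> i m mK; rewrite upd_diff //; apply/eqP => -[_ e].
  by move: mK; rewrite e leqNgt Kk.
split => // P DP; rewrite /Dt; congr (_ + _); apply: eq_bigr => j _.
rewrite (fsbig_ord _ _ (fun k => pd (Some (j, k)) u P * P (Some (j, k.+1)))).
apply/esym; apply: fsbig_widen => // k [_ /= /negP].
by rewrite -leqNgt => Kk; rewrite h0 // mul0r.
Qed.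

Lemma smooth_Dt D u : open D -> smooth D u -> smooth D (Dt u).
Proof.
move=> oD hu; have [K [_ hK]] := DtE oD hu.1.
apply: (@eq_on_smooth D (fun P => pd None u P +
    \sum_j \sum_(k < K) pd (Some (j, k : nat)) u P * P (Some (j, k.+1)))) => //.
  by move=> P; rewrite inE => /hK.
apply: smooth_add => //; first exact: smooth_pd.
apply: smooth_sum => // j; apply: smooth_sum => // k.
by apply: smooth_mul => //; [exact: smooth_pd|exact: smooth_coord].
Qed.

Lemma smooth_iter_Dt D u n : open D -> smooth D u -> smooth D (iter n Dt u).
Proof. by move=> oD hu; elim: n => //= n; exact: smooth_Dt. Qed.

End SmoothClosure.

(** * Vanishing partial derivatives and orders of total derivatives *)

Section Independence.
Context {R : realType} {V : finType}.
Implicit Types (P Q : jet R V) (a b : coord V) (s t : seq (coord V)) (u w : expr R V) (D : set (jet R V)).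

Lemma const_along D a u P s e Q h h' : box s e P `<=` D -> pdable D a u ->
  (forall Q, D Q -> pd a u Q = 0) -> box s e P Q ->
  `|h - P a| < e -> `|h' - P a| < e -> u (upd Q a h) = u (upd Q a h').
Proof.
move=> bD ha h0 bQ.
suff H x : `|x - P a| < e -> u (upd Q a x) = u (upd Q a (P a)).
  by move=> /H -> /H ->.
move=> xe; apply/eqP; rewrite -subr_eq0; apply/eqP.
have [|_ _ ->] := @mvt_closed R (fun y => u (upd Q a y)) (fun=> 0) (P a) x.
  move=> z /le_lt_trans /(_ xe) ze; have Dz : D (upd Q a z) by apply: bD; exact: box_upd.
  have := ha _ Dz; rewrite h0 // upd_same.
  by under eq_fun do rewrite upd_upd.
by rewrite mul0r.
Qed.

(** Coordinates are changed one at a time; every intermediate point stays in the box, hence in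
    [D]. *)
Lemma const_box D u P t e s Q Q' : box t e P `<=` D ->
  (forall a, a \in s -> pdable D a u /\ forall Q, D Q -> pd a u Q = 0) ->
  {subset s <= t} -> box t e P Q -> box t e P Q' ->
  (forall a, a \notin s -> Q a = Q' a) -> u Q = u Q'.
Proof.
move=> bD; elim: s Q => [|a s ih] Q hs st bQ bQ' QQ'.
  by congr u; apply/funext => a; exact: QQ'.
have [ha h0] := hs a (mem_head _ _).
have at_ : a \in t by apply: st; exact: mem_head.
rewrite -{1}(upd_id Q a) (const_along (h' := Q' a) bD ha h0 bQ (bQ _ at_) (bQ' _ at_)).
apply: ih => //.
- by move=> b bs; apply: hs; rewrite inE bs orbT.
- by move=> b bs; apply: st; rewrite inE bs orbT.
- by apply: box_upd => //; exact: bQ'.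
move=> b bs; rewrite /upd; case: eqP => [->//|/eqP ba].
by apply: QQ'; rewrite inE negb_or ba.
Qed.

(** Only finitely many coordinates move on [C], so [u] is locally constant there and its level sets
    are relatively open and closed. *)
Lemma const_connected D u (C : set (jet R V)) s P Q : open D ->
  (forall a, a \in s -> pdable D a u /\ forall Q, D Q -> pd a u Q = 0) ->
  connected C -> C `<=` D -> C P ->
  (forall Q, C Q -> forall a, a \notin s -> Q a = P a) -> C Q -> u Q = u P.
Proof.
move=> oD hs cC CD CP hC CQ.
have loc X : C X -> nbhs X [set Y | C Y -> u Y = u X].
  move=> CX; have [t [e [ep tD]]] := open_box oD (CD _ CX).
  apply/nbhs_boxP; exists (s ++ t), e; split => // Y bY CY.
  have sub : box (s ++ t) e X `<=` box t e X.
    by apply: box_sub => // a at_; rewrite mem_cat at_ orbT.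
  apply: (@const_box D u X (s ++ t) e s) => //.
  - by move=> Z /sub /tD.
  - by move=> a as_; rewrite mem_cat as_.
  - exact: box_refl.
  - by move=> a as_; rewrite !hC.
pose U := [set X | u X = u P].
suff : C `&` U = C by move=> e; move: CQ; rewrite -e => -[].
apply: cC.
- by exists P.
(* The level set need not be open among all jets; this interior is open and has the same trace on
   [C]. *)
- exists (interior (~` C `|` U)); first exact: open_interior.
  apply/seteqP; split=> X [CX UX]; split => //; last first.
    by have /interior_subset[] := UX.
  by apply: filterS (loc X CX) => Y h; have [CY|CY] := pselect (C Y); [right; rewrite /U /= h|left].
- exists (~` interior (~` C `|` ~` U)); first by apply: open_closedC; exact: open_interior.
  apply/seteqP; split=> X [CX UX]; split => //.
    by move=> /interior_subset[].
  apply/not_notP => nU; apply: UX.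
  by apply: filterS (loc X CX) => Y h; have [CY|CY] := pselect (C Y); [right; rewrite /U /= h|left].
Qed.

(** Shifting a short segment in direction [b] along [a] does not change the values of [u] on it,
    hence not its derivative along [b]. *)
Lemma near_pd_indep D a b u P : open D -> pdable D a u -> (forall Q, D Q -> pd a u Q = 0) ->
  D P -> \forall h \near P a, pd b u (upd P a h) = pd b u P.
Proof.
move=> oD ha h0 DP; have [s [e [ep bD]]] := open_box oD DP.
apply/nbhs_ballP; exists e => //= h; rewrite /ball /= distrC => he.
have bP : box s e P P by exact: box_refl.
have Dh : D (upd P a h) by apply: bD; exact: box_upd.
have [<-|ab] := eqVneq a b; first by rewrite !h0.
rewrite /pd !derive1E upd_diff 1?eq_sym //; apply: near_eq_derive.
apply/nbhs_ballP; exists e => //= h'; rewrite /ball /= distrC => he'.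
have bh' : box s e P (upd P b h') by exact: box_upd.
rewrite updC // (const_along (h' := P a) bD ha h0 bh' he) ?subrr ?normr0 //.
by rewrite -updC // upd_id.
Qed.

Lemma near_pd_indep_seq D a u P (bs : seq (coord V)) : open D -> pdable D a u ->
  (forall Q, D Q -> pd a u Q = 0) -> D P ->
  \forall h \near P a, forall b, b \in bs -> pd b u (upd P a h) = pd b u P.
Proof.
move=> oD ha h0 DP; elim: bs => [|b bs ih]; first by near=> h.
apply: filterS2 (near_pd_indep b oD ha h0 DP) ih => h hb hbs c.
by rewrite inE => /predU1P[->//|]; exact: hbs.
Unshelve. all: by end_near.
Qed.

Lemma is_derive_bigsum (T : Type) (r : seq T) (F : T -> R -> R) (d : T -> R) (x : R) :
  (forall i, is_derive x 1 (F i) (d i)) ->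
  is_derive x 1 (fun h => \sum_(i <- r) F i h) (\sum_(i <- r) d i).
Proof.
move=> hF; elim: r => [|i r ih].
  under eq_fun do rewrite big_nil.
  by rewrite big_nil; exact: (is_derive_cst (0 : R)).
under eq_fun do rewrite big_cons.
by rewrite big_cons; exact: (is_deriveD (hF i) ih).
Qed.

(* Only the terms [pd (x, m) u * x^(m+1)] of [Dt u] can depend on [x^(m+1)]. *)
Lemma pd_Dt D a u P : open D -> smooth D u -> (forall Q, D Q -> pd a u Q = 0) -> D P ->
  pd a (Dt u) P = if a is Some (x, m.+1) then pd (Some (x, m)) u P else 0.
Proof.
move=> oD hu h0 DP; have [K [hK hDt]] := DtE oD hu.1.
(* [g] is [Dt u] along the line with coefficients frozen at [P]. None of them varies with [a] near
   [P], and they are finitely many, so one neighbourhood serves all. *)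
pose g (h : R) : R := pd None u P +
  \sum_j \sum_(k < K) pd (Some (j, k : nat)) u P * upd P a h (Some (j, k.+1)).
have eg : \forall h \near P a, Dt u (upd P a h) = g h.
  pose bs := None :: [seq Some (j, k) | j <- enum V, k <- iota 0 K].
  apply: filterS2 (near_open_upd a oD DP)
    (near_pd_indep_seq bs oD (smooth_pdable a hu) h0 DP) => h Dh hb.
  rewrite hDt // hb ?mem_head //; congr (_ + _).
  apply: eq_bigr => j _; apply: eq_bigr => k _; rewrite hb //.
  by rewrite inE; apply/orP; right; apply/allpairsP; exists (j, k : nat); rewrite mem_enum mem_iota ltn_ord.
have dg : is_derive (P a) 1 g
    (0 + \sum_j \sum_(k < K) (pd (Some (j, k : nat)) u P * (Some (j, k.+1) == a)%:R)).
  apply: (is_deriveD (is_derive_cst (pd None u P : R) _ _)).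
  apply: is_derive_bigsum => j; apply: is_derive_bigsum => k.
  apply: is_derive_eq (is_deriveM (is_derive_cst (pd (Some (j, k : nat)) u P : R) _ _)
    (is_derive_coord P a _)) _.
  by rewrite /GRing.scale /= mulr0 addr0.
rewrite [LHS]/pd derive1E (near_eq_derive _ eg) derive_val add0r.
have off (x : V) (k m : nat) : k <> m -> (Some (x, k) == Some (x, m) :> coord V) = false.
  by move=> km; apply/eqP => -[].
case: a h0 g eg dg => [[x [|m]]|] h0 g eg dg.
- by rewrite big1 // => j _; rewrite big1 // => k _; rewrite (_ : _ == _ = false) ?mulr0 //; apply/eqP => -[].
- rewrite (bigD1 x) //= [X in _ + X]big1 ?addr0; last first.
    move=> j jx; rewrite big1 // => k _; rewrite (_ : _ == _ = false) ?mulr0 //.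
    by apply/eqP => -[e]; rewrite e eqxx in jx.
  have [mK|Km] := ltnP m K.
    rewrite (bigD1 (Ordinal mK)) //= eqxx mulr1 big1 ?addr0 //.
    move=> k km; rewrite off ?mulr0 // => -[e]; move: km.
    by rewrite -val_eqE /= e eqxx.
  rewrite big1 => [|k _]; first by rewrite hK.
  rewrite off ?mulr0 // => -[e]; move: Km; rewrite -e leqNgt; case: k {e} => k /= ->.
  by [].
- by rewrite big1 // => j _; rewrite big1 // => k _; rewrite mulr0.
Qed.

(** The bound is an integer because differences such as [d j - c i - 1] can be negative; a negative
    bound says that [x] does not occur on [D]. *)
Definition order_le D (x : V) (b : int) u :=
  forall (m : nat) P, D P -> b < m%:Z -> pd (Some (x, m)) u P = 0.

Lemma order_le_Dt D x (b : int) u : open D -> smooth D u -> order_le D x b u ->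
  order_le D x (b + 1) (Dt u).
Proof.
move=> oD hu hb m P DP bm; rewrite (@pd_Dt D) //; last first.
  by move=> Q DQ; apply: hb => //; lia.
by case: m bm => // m bm; apply: hb => //; lia.
Qed.

Lemma order_le_iter_Dt D x (b : int) u n : open D -> smooth D u -> order_le D x b u ->
  order_le D x (b + n%:Z) (iter n Dt u).
Proof.
move=> oD hu hb; elim: n => [|n ih] /=; first by rewrite addr0.
have -> : b + n.+1%:Z = b + n%:Z + 1 by lia.
by apply: order_le_Dt => //; exact: smooth_iter_Dt.
Qed.

(** This is Griewank's lemma: by [pd_Dt], each total differentiation moves the leading coefficient
    up one order unchanged. *)
Lemma pd_iter_Dt D x m u n P : open D -> smooth D u -> order_le D x m%:Z u -> D P ->
  pd (Some (x, (m + n)%N)) (iter n Dt u) P = pd (Some (x, m)) u P.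
Proof.
move=> oD hu hb DP; elim: n => [|n ih] /=; first by rewrite addn0.
rewrite addnS (@pd_Dt D) //; first exact: smooth_iter_Dt.
by move=> Q DQ; have := order_le_iter_Dt (n := n) oD hu hb; apply => //; lia.
Qed.

End Independence.

(** * Chain rule along a path that moves finitely many coordinates *)

Section ChainRule.
Context {R : realType} {V : finType}.
Implicit Types (P Q : jet R V) (a b : coord V) (s : seq (coord V)) (u w : expr R V) (D : set (jet R V)).

(** Induction on [s]: freeze the coordinate [a], and express the difference by the mean value
    theorem as a partial derivative at an intermediate point, which tends to [g t0]. *)
Lemma chain_rule D u (s : seq (coord V)) (g : R -> jet R V) (dg : coord V -> R) (t0 : R) :
  open D -> smooth D u -> D (g t0) -> uniq s ->
  (forall a, a \in s -> is_derive t0 1 (fun t => g t a : R) (dg a)) ->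
  (forall t a, a \notin s -> g t a = g t0 a) ->
  is_derive t0 1 (fun t => u (g t) : R) (\sum_(a <- s) pd a u (g t0) * dg a).
Proof.
move=> oD hu; elim: s g => [|a s ih] g Dg /= us hg gs.
  rewrite big_nil (_ : (fun t => _) = cst (u (g t0) : R)); first exact: is_derive_cst.
  by apply/funext => t; congr u; apply/funext => b; exact: gs.
have /andP[as_ {}us] := us.
pose g1 t := upd (g t) a (g t0 a).
have g1t0 : g1 t0 = g t0 by rewrite /g1 upd_id.
have h1 : is_derive t0 1 (fun t => u (g1 t) : R) (\sum_(b <- s) pd b u (g t0) * dg b).
  rewrite -g1t0; apply: ih => //; first by rewrite g1t0.
  - move=> b bs; have ba : b != a by apply: contraNneq as_ => <-.
    under eq_fun do rewrite /g1 upd_diff //.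
    by apply: hg; rewrite inE bs orbT.
  - move=> t b bs; rewrite /g1 /upd; case: eqP => // /eqP ba.
    by apply: gs; rewrite inE negb_or ba.
have /is_derive1_caratheodory[G [GE cG G0]] := hg a (mem_head _ _).
have cg b : {for t0, continuous (fun t => g t b : R)}.
  have [bs|bs] := boolP (b \in a :: s).
    by have [d _] := hg b bs; exact/differentiable_continuous/derivable1_diffP.
  rewrite (_ : (fun t => _) = cst (g t0 b : R)); first exact: cst_continuous.
  by apply/funext => t; exact: gs.
have near_g b e : 0 < e -> \forall t \near t0, `|g t b - g t0 b| < e.
  move=> ep; apply: (cg b [set x | `|x - g t0 b| < e]).
  by apply/nbhs_ballP; exists e => //= x; rewrite /ball /= distrC.
have near_box bs e : 0 < e -> \forall t \near t0, box bs e (g t0) (g t).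
  move=> ep; elim: bs => [|b bs ihb]; first by near=> t.
  apply: filterS2 (near_g b e ep) ihb => t hb hbs c.
  by rewrite inE => /predU1P[->//|]; exact: hbs.
have [t [e [ep bD]]] := open_box oD Dg.
(* Outside the box the default [g t0 a] is taken, so that the intermediate point is defined for
   every [x] and the distance bound always holds. *)
have ex_z x : exists z : R, `|z - g t0 a| <= `|g x a - g t0 a| /\
   (box (a :: t) e (g t0) (g x) ->
    u (g x) - u (g1 x) = pd a u (upd (g x) a z) * (g x a - g t0 a)).
  have [bx|bx] := pselect (box (a :: t) e (g t0) (g x)); last first.
    by exists (g t0 a); rewrite subrr normr0; split.
  have [|z hz ez] := @mvt_closed R (fun h => u (upd (g x) a h))
      (fun h => pd a u (upd (g x) a h)) (g t0 a) (g x a).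
    move=> z hz; have Dz : D (upd (g x) a z).
      apply: bD; apply: box_upd.
        by apply: box_sub bx => // b bt; rewrite inE bt orbT.
      by apply: le_lt_trans hz _; apply: bx; exact: mem_head.
    have := smooth_pdable a hu Dz; rewrite upd_same.
    by under eq_fun do rewrite upd_upd.
  by exists z; split => // _; rewrite -ez upd_id.
have [z hz] := choice ex_z.
pose xi x := upd (g x) a (z x).
have cxi : {for t0, continuous xi}.
  move=> A; rewrite /xi (_ : upd (g t0) a (z t0) = g t0); last first.
    have := (hz t0).1; rewrite subrr normr0 normr_le0 subr_eq0 => /eqP ->.
    exact: upd_id.
  move=> /nbhs_boxP[bs [e' [e'p bA]]].
  apply: filterS (near_box (a :: bs) e' e'p) => x hx; apply: bA.
  apply: box_upd; first by apply: box_sub hx => // b hb; rewrite inE hb orbT.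
  by apply: le_lt_trans (hz x).1 _; apply: hx; exact: mem_head.
have xi0 : xi t0 = g t0.
  rewrite /xi; have := (hz t0).1; rewrite subrr normr0 normr_le0 subr_eq0 => /eqP ->.
  exact: upd_id.
(* Caratheodory's criterion asks of the factor only continuity at [t0], which is all that is known
   of a point obtained by choice. *)
have h2 : is_derive t0 1 (fun x => pd a u (xi x) * G x * (x - t0) : R) (pd a u (g t0) * dg a).
  apply/is_derive1_caratheodory; exists (fun x => pd a u (xi x) * G x); split.
  - by move=> x; rewrite subrr mulr0 subr0.
  - apply: (@continuousM _ _ (fun x => pd a u (xi x)) G) => //.
    apply: (@continuous_comp _ _ _ xi (pd a u)) => //.
    by rewrite xi0; apply: smooth_cont Dg; exact: smooth_pd.
  - by rewrite xi0 G0.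
rewrite big_cons; apply: near_eq_is_derive (is_deriveD h2 h1).
apply: filterS (near_box (a :: t) e ep) => x hx /=.
by rewrite /= -[RHS](subrK (u (g1 x))) (hz x).2 // GE mulrA.
Unshelve. all: by end_near.
Qed.

End ChainRule.

(** * Orders of the expressions of the new system *)

Section OldPart.
Context {R : realType} {I : finType}.
Variables (D : set (jet R I)) (v : I -> expr R I) (l : I).
Implicit Types (u : expr R I) (P : jet R (newI D v l)) (a : coord I).

Definition old_coord a : coord (newI D v l) :=
  if a is Some (j, k) then Some (inl j, k) else None.

Lemma old_coord_inj : injective old_coord.
Proof. by move=> [[j k]|] [[j' k']|] //= [-> ->]. Qed.

Lemma old_partE P a : old_part P a = P (old_coord a).
Proof. by case: a => [[]|]. Qed.

Lemma old_part_cont P : {for P, continuous (fun Q : jet R (newI D v l) => old_part Q)}.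
Proof.
move=> A /nbhs_boxP[s [e [ep h]]]; apply/nbhs_boxP.
exists (map old_coord s), e; split => // Q hQ; apply: h => a as_.
by rewrite !old_partE; apply: hQ; exact: map_f.
Qed.

Lemma old_part_upd P a h : old_part (upd P (old_coord a) h) = upd (old_part P) a h.
Proof.
apply/funext => b; rewrite /upd !old_partE (inj_eq old_coord_inj).
by case: eqP.
Qed.

Lemma old_part_upd_new P y k h : old_part (upd P (Some (inr y, k)) h) = old_part P.
Proof. by apply/funext => b; rewrite !old_partE upd_diff //; case: b => [[]|]. Qed.

Lemma pd_old a u : pd (old_coord a) (u \o @old_part _ _ D v l) =
  pd a u \o @old_part _ _ D v l.
Proof.
apply/funext => P; rewrite /pd /= -old_partE; congr derive1; apply/funext => h.
by rewrite /= old_part_upd.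
Qed.

Lemma pd_old_new y k u : pd (Some (inr y, k)) (u \o @old_part _ _ D v l) = fun=> 0.
Proof.
apply/funext => P; rewrite -[RHS](congr1 (fun f => f P)
  (pd_cst (V := newI D v l) (Some (inr y, k)) (u (old_part P)))).
by rewrite /pd; congr derive1; apply/funext => h /=; rewrite old_part_upd_new.
Qed.

(** The conditions of [new_domain] without the one on slices: an open set, on which the calculus is
    carried out before restricting to [new_domain]. *)
Definition regular : set (jet R (newI D v l)) := [set P | D (old_part P) /\ v l (old_part P) <> 0].

Lemma Cn_old n u : Cn n D u -> Cn n regular (u \o @old_part _ _ D v l).
Proof.
elim: n u => [|n ih] u hu; split => //;
  try by move=> P [DP _]; apply: continuous_comp; [exact: old_part_cont|exact: Cn_cont hu DP].
case=> [[[j|y] k]|].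
- rewrite (pd_old (Some (j, k))); split; last exact: ih (Cn_pd _ hu).
  move=> P [DP _]; rewrite (pd_old (Some (j, k))) /=.
  have := Cn_pdable (Some (j, k)) hu DP.
  by under eq_fun do rewrite -old_part_upd.
- rewrite pd_old_new; split; last exact: Cn_cst.
  move=> P [DP _]; rewrite pd_old_new.
  rewrite [X in is_derive _ _ X](_ : _ = cst (u (old_part P) : R)); first exact: is_derive_cst.
  by apply/funext => h /=; rewrite old_part_upd_new.
- rewrite (pd_old None); split; last exact: ih (Cn_pd _ hu).
  move=> P [DP _]; rewrite (pd_old None) /=.
  have := Cn_pdable None hu DP.
  by under eq_fun do rewrite -old_part_upd.
Qed.

Lemma smooth_old u : smooth D u -> smooth regular (u \o @old_part _ _ D v l).
Proof.
move=> [[K hK] hn]; split; last by move=> n; exact: Cn_old.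
exists K => P Q [DP _] [DQ _] [h0 h1]; apply: hK => //; split => // j k kK.
exact: h1.
Qed.

Lemma open_regular : open D -> smooth D (v l) -> open regular.
Proof.
move=> oD hv; rewrite openE => P [DP vP].
have h1 : \forall Q \near P, D (old_part Q).
  exact: (old_part_cont (open_nbhs_nbhs (conj oD DP))).
have h2 : \forall Q \near P, v l (old_part Q) != 0.
  apply: (@old_part_cont P [set X | v l X != 0]).
  have cv : {for old_part P, continuous (v l)} by exact: smooth_cont DP.
  apply: (cv [set x | x != 0]).
  by apply: open_nbhs_nbhs; split; [exact: open_neq|exact/eqP].
by apply: filterS2 h1 h2 => Q hQ /eqP.
Qed.

End OldPart.

(** * Order bounds for each row of the converted system *)

Section NewSystem.
Context {R : realType} {I : finType}.
Variables (D : set (jet R I)) (f : I -> expr R I) (c d : I -> int).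
Variables (B : {set I}) (v : I -> expr R I) (l : I).

Local Notation J := (Jset D v).
Local Notation cb := (cbar D f c d B v).
Local Notation E := (@regular _ _ D v l).
Local Notation ND := (new_domain D f c d B v l).
Local Notation pat := (pattern (signature D f) c d).
Local Notation ye := (@yexpr _ _ D f c d B v l).
Local Notation sub := (@substituted _ _ D f c d B v l).
Local Notation rep := (replaced D f c d v l).
Local Notation nI := (newI D v l).

Hypothesis oD : open D.
Hypothesis smf : forall i, smooth D (f i).
Hypothesis smv : forall j, smooth D (v j).
Hypothesis fle : forall i j, order_le D j (d j - c i) (f i).
Hypothesis flt : forall i j, ~~ pat i j -> order_le D j (d j - c i - 1) (f i).
(** Stands for the indices in blocks before the singular one. *)
Variable low : pred I.
Hypothesis vle : forall i j, order_le D j (d j - cb) (v i).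
Hypothesis vlt : forall i j, j \in J \/ low j -> order_le D j (d j - cb - 1) (v i).
Hypothesis dge : forall j, j \in J -> 0 <= d j - cb.
Hypothesis lJ : l \in J.
Hypothesis ker : forall i P, i \in B -> D P ->
  \sum_j system_jacobian D f c d i j P * v j P = 0.

Lemma open_regular_v : open E.
Proof. exact: open_regular. Qed.

Lemma new_domain_regular P : ND P -> E P.
Proof. by case. Qed.

Lemma JsetP j : reflect (nonzero_on D (v j)) (j \in J).
Proof. by rewrite inE; exact: asboolP. Qed.

Lemma eq0_notin_Jset j P : j \notin J -> D P -> v j P = 0.
Proof. by move=> /JsetP nJ DP; apply/not_notP => n; apply: nJ; exists P. Qed.

Lemma c_le_cbar i j : i \in B -> j \in J -> pat i j -> c i <= cb.
Proof.
move=> iB jJ ij; apply: (@bigmax_sup _ _ _ _ i) => //.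
by rewrite inE iB; apply/existsP; exists j; rewrite jJ.
Qed.

Lemma replacedP i j k : rep i (Some (j, k)) ->
  [/\ j \in J, j != l, pat i j & k = absz (d j - c i)].
Proof. by move=> /= /and3P[]; rewrite in_setD1 => /andP[? ?] ? /eqP ->. Qed.

Lemma substituted_old i P b : ~~ rep i b -> sub i P b = old_part P b.
Proof. by case: b => [[j k]|] //= /negbTE ->; case: insubP. Qed.

Lemma substituted_replaced i j k : rep i (Some (j, k)) -> exists2 y : {j | j \in J :\ l},
  val y = j & forall P, sub i P (Some (j, k)) = iter (absz (cb - c i)) Dt (ye y) P.
Proof.
move=> h; have jJ : j \in J :\ l by move: h => /and3P[].
exists (Sub j jJ); first by rewrite SubK.
move=> P; rewrite /sub h; case: insubP => [y _ e|]; last by rewrite jJ.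
by rewrite (_ : y = Sub j jJ) //; apply: val_inj; rewrite /= e.
Qed.

Lemma smooth_ratio j : smooth E (@Defs.ratio _ _ D v l j).
Proof.
apply: (@smooth_mul _ _ E (v j \o @old_part _ _ D v l)
  (fun P => (v l (old_part P))^-1) open_regular_v); first exact: (smooth_old v l (smv j)).
apply: (@smooth_inv _ _ E (v l \o @old_part _ _ D v l) open_regular_v).
  by move=> P [_ /eqP].
exact: smooth_old.
Qed.

Lemma pd_ratio a j P : E P -> (forall Q, D Q -> pd a (v j) Q = 0) ->
  (forall Q, D Q -> pd a (v l) Q = 0) -> pd (@old_coord _ _ D v l a) (@Defs.ratio _ _ D v l j) P = 0.
Proof.
move=> EP hj hl; rewrite (pd_mul EP).
- rewrite (pd_inv (u := v l \o @old_part _ _ D v l) EP).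
  + by rewrite !pd_old /= hj ?hl ?mul0r ?mulr0 ?addr0 //; case: EP.
  + by move=> Q [_ /eqP].
  + by apply: smooth_pdable; exact: smooth_old.
- by apply: smooth_pdable; exact: (smooth_old v l (smv j)).
- apply: smooth_pdable; apply: (@smooth_inv _ _ E (v l \o @old_part _ _ D v l) open_regular_v).
    by move=> Q [_ /eqP].
  exact: smooth_old.
Qed.

Lemma pd_ratio_new y k j P : E P -> pd (Some (inr y, k)) (@Defs.ratio _ _ D v l j) P = 0.
Proof.
move=> EP; rewrite (_ : Defs.ratio j = (fun Q => v j Q / v l Q) \o @old_part _ _ D v l) //.
by rewrite pd_old_new.
Qed.

Lemma order_le_ratio j k b : order_le D k b (v j) -> order_le D k b (v l) ->
  order_le E (inl k : nI) b (@Defs.ratio _ _ D v l j).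
Proof.
move=> hj hl m P EP bm; apply: (@pd_ratio (Some (k, m))) => // Q DQ.
  exact: hj.
exact: hl.
Qed.

Lemma smooth_yexpr y : smooth E (ye y).
Proof.
have oE := open_regular_v; apply: smooth_add => //; first exact: smooth_coord.
by apply: smooth_mul => //; [exact: smooth_ratio|exact: smooth_coord].
Qed.

Lemma pd_yexpr a y P : E P -> pd a (ye y) P = (Some (inr y, 0%N) == a)%:R +
  (Defs.ratio (val y) P * (Some (inl l, absz (d l - cb)) == a)%:R +
   P (Some (inl l, absz (d l - cb))) * pd a (@Defs.ratio _ _ D v l (val y)) P).
Proof.
have oE := open_regular_v; move=> EP; rewrite (pd_add EP); first last.
- by apply: smooth_pdable; apply: smooth_mul => //; [exact: smooth_ratio|exact: smooth_coord].
- exact: pdable_coord.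
rewrite (pd_mul EP); [|exact: smooth_pdable (smooth_ratio _)|exact: pdable_coord].
by rewrite /xder !pd_coord.
Qed.

Lemma order_le_yexpr y k : order_le E (inl k : nI) (d k - cb) (ye y).
Proof.
move=> m P EP km; rewrite pd_yexpr // (order_le_ratio (b := d k - cb)) //.
rewrite mulr0 addr0 (_ : _ == _ = false) ?add0r; last by [].
rewrite (_ : _ == _ = false) ?mulr0 //; apply/eqP => -[ek em].
by move: km; rewrite -ek -em; have := dge lJ; lia.
Qed.

(** As [v] has lower order in [x_k], the bound [d k - cb] could be reached only by the explicit
    derivative of [x_l], and both alternatives exclude [k = l]. *)
Lemma order_lt_yexpr y k : (k \in J /\ k != l) \/ (low k && (k \notin J)) ->
  order_le E (inl k : nI) (d k - cb - 1) (ye y).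
Proof.
move=> hk m P EP km.
have kl : k != l by case: hk => [[]//|/andP[_]]; apply: contraNneq => ->.
have kv : k \in J \/ low k by case: hk => [[]|/andP[]]; [left|right].
rewrite pd_yexpr // (order_le_ratio (b := d k - cb - 1)) //; last first.
- exact: vlt.
- exact: vlt.
rewrite mulr0 addr0 (_ : _ == _ = false) ?add0r; last by [].
by rewrite (_ : _ == _ = false) ?mulr0 //; apply/eqP => -[ek em]; rewrite ek eqxx in kl.
Qed.

Lemma order_le_yexpr_new y z : order_le E (inr z : nI) 0 (ye y).
Proof.
move=> m P EP km; rewrite pd_yexpr // pd_ratio_new // !mulr0 !addr0.
by rewrite (_ : _ == _ = false) //; apply/eqP => -[_ em]; move: km; rewrite -em.
Qed.

(** The quotient contains [x_l] only in lower order, so the product rule leaves just the factor of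
    the explicit derivative. *)
Lemma pd_yexpr_l y m P : m%:Z = d l - cb -> E P ->
  pd (Some (inl l : nI, m)) (ye y) P = Defs.ratio (val y) P.
Proof.
move=> ml EP; rewrite pd_yexpr // (order_le_ratio (b := d l - cb - 1)) //; last first.
- by lia.
- by apply: vlt; left.
- by apply: vlt; left.
rewrite mulr0 addr0 (_ : _ == _ = false) ?add0r; last by [].
by rewrite -ml absz_nat eqxx mulr1.
Qed.

(** The list [s] is free, provided that it covers the replaced coordinates and the one corresponding
    to [a], if any: the other arguments of [f i] do not move. *)
Lemma pd_new_dae_in i a P (s : seq (coord I)) : i \in B -> ND P -> uniq s ->
  (forall b, b \notin s -> ~~ rep i b /\ @old_coord _ _ D v l b != a) ->
  pd a (new_dae D f c d B v l (inl i)) P = \sum_(b <- s)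
    pd b (f i) (sub i P) * pd a (fun Q => sub i Q b) P.
Proof.
move=> iB NP us hs; have EP := new_domain_regular NP; have oE := open_regular_v.
have DS : D (sub i P) by have [_ _ /(_ _ iB)[C [_ CD _ CS _]]] := NP; exact: CD.
apply: pd_val; rewrite /new_dae iB.
have := @chain_rule _ _ D (f i) s (fun h => sub i (upd P a h))
  (fun b => pd a (fun Q => sub i Q b) P) (P a).
rewrite /= upd_id; apply => //.
- move=> b _; have [rb|rb] := boolP (rep i b); last first.
    rewrite (_ : (fun Q => sub i Q b) = (fun Q => Q (@old_coord _ _ D v l b))); last first.
      by apply/funext => Q; rewrite substituted_old // old_partE.
    under eq_fun do rewrite substituted_old // old_partE.
    exact: (pdable_coord (D := setT)).
  case: b rb => [[j k]|//] rb; have [y _ hy] := substituted_replaced rb.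
  rewrite (_ : (fun Q => sub i Q _) = iter (absz (cb - c i)) Dt (ye y)); last first.
    by apply/funext => Q; rewrite hy.
  under eq_fun do rewrite hy.
  by apply: (@smooth_pdable _ _ E) => //; apply: smooth_iter_Dt => //; exact: smooth_yexpr.
- by move=> t b /hs[rb ba]; rewrite !substituted_old // !old_partE upd_diff.
Qed.

Lemma pd_substituted_old i b a P : ~~ rep i b ->
  pd a (fun Q => sub i Q b) P = (@old_coord _ _ D v l b == a)%:R.
Proof.
move=> rb; rewrite (_ : (fun Q => _) = (fun Q => Q (@old_coord _ _ D v l b))) ?pd_coord //.
by apply/funext => Q; rewrite substituted_old // old_partE.
Qed.

(** One coordinate per variable, inside the pattern or not, so that the chain rule sum is indexed
    like a row of the System Jacobian. *)
Definition top_coords i : seq (coord I) := [seq Some (j, absz (d j - c i)) | j <- enum I].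

Lemma replaced_top i b : rep i b -> b \in top_coords i.
Proof. by case: b => [[j k]|//] /replacedP[_ _ _ ->]; rewrite map_f // mem_enum. Qed.

Lemma uniq_top_coords i : uniq (top_coords i).
Proof. by rewrite map_inj_uniq ?enum_uniq // => j j' []. Qed.

Lemma pd_new_dae_in_eq0 i a P : i \in B -> ND P ->
  (forall y : {j | j \in J :\ l}, pat i (val y) -> c i <= cb ->
     pd a (iter (absz (cb - c i)) Dt (ye y)) P = 0) ->
  (forall b, ~~ rep i b -> @old_coord _ _ D v l b = a -> pd b (f i) (sub i P) = 0) ->
  pd a (new_dae D f c d B v l (inl i)) P = 0.
Proof.
move=> iB NP hy hb.
pose olds : seq (coord I) := match a with
  | None => [:: None] | Some (inl j, k) => [:: Some (j, k)] | _ => [::] end.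
rewrite (@pd_new_dae_in i a P (undup (olds ++ top_coords i))) ?undup_uniq //; last first.
  move=> b; rewrite mem_undup mem_cat negb_or => /andP[bo bt]; split.
    by apply: contraNN bt; exact: replaced_top.
  by apply/eqP => e; move: bo; rewrite /olds -e; case: b {bt e} => [[j k]|]; rewrite ?inE ?eqxx.
rewrite big1_seq // => b _; have [rb|rb] := boolP (rep i b); last first.
  rewrite pd_substituted_old //; case: eqP => [e|_]; last by rewrite mulr0.
  by rewrite hb // mul0r.
case: b rb => [[j k]|//] rb; have [y yj hs] := substituted_replaced rb.
have [jJ _ pij _] := replacedP rb.
rewrite (_ : (fun Q => _) = iter (absz (cb - c i)) Dt (ye y)); last first.
  by apply/funext => Q; rewrite hs.
rewrite hy ?mulr0 ?yj //; exact: c_le_cbar pij.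
Qed.

(** The order [d k - cb] of the substituted expression, raised by [cb - c i] total differentiations,
    is [d k - c i]. *)
Lemma order_le_new_dae_in i k : i \in B -> order_le ND (inl k : nI) (d k - c i)
  (new_dae D f c d B v l (inl i)).
Proof.
move=> iB m P NP km; have EP := new_domain_regular NP.
have DS : D (sub i P) by have [_ _ /(_ _ iB)[C [_ CD _ CS _]]] := NP; exact: CD.
apply: pd_new_dae_in_eq0 => //.
  move=> y _ ci.
  have := order_le_iter_Dt (n := absz (cb - c i)) open_regular_v (smooth_yexpr y) (@order_le_yexpr y k).
  by apply => //; lia.
move=> [[j k']|] // _ [-> ->]; exact: (fle DS).
Qed.

Lemma order_le_new_dae_in_new i y : i \in B -> order_le ND (inr y : nI) (cb - c i)
  (new_dae D f c d B v l (inl i)).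
Proof.
move=> iB m P NP km; have EP := new_domain_regular NP; apply: pd_new_dae_in_eq0 => //.
  move=> z _ ci.
  have := order_le_iter_Dt (n := absz (cb - c i)) open_regular_v (smooth_yexpr z) (@order_le_yexpr_new z y).
  by apply => //; lia.
by case=> [[]|].
Qed.

Lemma order_lt_new_dae_in i k : i \in B -> (k \in J /\ k != l) \/ [/\ low k, k \notin J & ~~ pat i k] ->
  order_le ND (inl k : nI) (d k - c i - 1) (new_dae D f c d B v l (inl i)).
Proof.
move=> iB hk m P NP km; have EP := new_domain_regular NP.
have DS : D (sub i P) by have [_ _ /(_ _ iB)[C [_ CD _ CS _]]] := NP; exact: CD.
apply: pd_new_dae_in_eq0 => //.
  move=> y _ ci.
  have hk' : (k \in J /\ k != l) \/ (low k && (k \notin J)).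
    by case: hk => [?|[-> -> _]]; [left|right].
  have := order_le_iter_Dt (n := absz (cb - c i)) open_regular_v (smooth_yexpr y) (order_lt_yexpr y hk').
  by apply => //; lia.
move=> [[j k']|] // rb [ej ek]; rewrite {}ej {}ek in rb *.
have [pk|/flt] := boolP (pat i k); last by apply => //; lia.
case: hk => [[kJ kl]|[_ _]]; last by rewrite pk.
(* Not being replaced, the coordinate has [m] different from [absz (d k - c i)]; as [d k - c i] is
   at least [d k - cb], hence nonnegative, [m] exceeds it. *)
apply: fle => //; have := c_le_cbar iB kJ pk; have := dge kJ.
move: rb; rewrite /= in_setD1 kJ kl pk /= => /eqP; lia.
Qed.

(* The connected slice in [new_domain] is what makes [v] take the same value
   before and after substitution: [v] does not depend on the replaced variables. *)
Lemma v_substituted i j P : i \in B -> ND P -> v j (sub i P) = v j (old_part P).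
Proof.
move=> iB NP; have [_ _ /(_ _ iB)[C [cC CD CP CS hC]]] := NP.
pose s := [seq b <- top_coords i | rep i b].
apply: (@const_connected _ _ D (v j) C s) => //.
- move=> b; rewrite mem_filter => /andP[rb _]; split; first exact: smooth_pdable.
  case: b rb => [[k m]|//] /replacedP[kJ _ pk ->] Q DQ.
  have : order_le D k (d k - cb - 1) (v j) by apply: vlt; left.
  apply => //; by have := c_le_cbar iB kJ pk; have := dge kJ; lia.
- move=> Q CQ b; rewrite mem_filter negb_and => /orP[rb|bt]; first exact: hC.
  by apply: hC => //; apply: contraNN bt; exact: replaced_top.
Qed.

(* The coefficient of the leading derivative of [x_l] is a multiple of a row of
   [J_qq v = 0]. *)
Lemma order_lt_new_dae_l i : i \in B ->
  order_le ND (inl l : nI) (d l - c i - 1) (new_dae D f c d B v l (inl i)).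
Proof.
move=> iB m P NP km; have EP := new_domain_regular NP.
have [|lm] := ltP (d l - c i) m%:Z; first exact: order_le_new_dae_in.
have ml : m%:Z = d l - c i by lia.
have [_ /eqP vl0] := EP.
have [_ _ /(_ _ iB)[C [_ CD _ CS _]]] := NP; have DS := CD _ CS.
have la : Some (l, absz (d l - c i)) = Some (l, m) by rewrite -ml absz_nat.
rewrite (@pd_new_dae_in i _ P (top_coords i)) ?uniq_top_coords //; last first.
  move=> b bt; split; first by apply: contraNN bt; exact: replaced_top.
  apply: contraNneq bt => e; have -> : b = Some (l, m) by apply: (@old_coord_inj _ _ D v l).
  by rewrite -la map_f // mem_enum.
rewrite big_map big_enum.
(* Jacobian row and [v] are taken at the substituted point, where the kernel identity applies; the
   denominator remains at the original point and factors out. *)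
rewrite (eq_bigr (fun j => system_jacobian D f c d i j (sub i P) * v j (sub i P) / v l (old_part P))).
  by rewrite -mulr_suml ker // mul0r.
move=> j _; rewrite v_substituted // /system_jacobian.
have [rb|rb] := boolP (rep i (Some (j, absz (d j - c i)))).
  have [y yj hs] := substituted_replaced rb; have [jJ jl pij _] := replacedP rb.
  have ci := c_le_cbar iB jJ pij; have dl := dge lJ.
  rewrite pij (_ : (fun Q => sub i Q (Some (j, absz (d j - c i)))) =
    iter (absz (cb - c i)) Dt (ye y)); last first.
    by apply/funext => Q; rewrite hs.
  (* The order splits into that of the explicit [x_l] and the number of differentiations, as
     [pd_iter_Dt] requires. *)
  have -> : m = (absz (d l - cb) + absz (cb - c i))%N by lia.
  rewrite (pd_iter_Dt (D := E)) //; last 3 first.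
  - exact: open_regular_v.
  - exact: smooth_yexpr.
  - by have := @order_le_yexpr y l; rewrite gez0_abs.
  by rewrite pd_yexpr_l ?gez0_abs // /Defs.ratio yj mulrA.
rewrite pd_substituted_old //=.
(* [x_l] is not replaced and contributes its own Jacobian entry, seen as multiplied and divided by
   [v_l]. *)
have [->|jl] := eqVneq j l.
  rewrite -ml absz_nat eqxx mulr1 mulfK //; case: ifPn => // /flt h.
  by apply: h => //; lia.
rewrite (_ : _ == _ = false) ?mulr0; last by apply/eqP => -[ej]; rewrite ej eqxx in jl.
case: ifPn => [pij|_]; last by rewrite !mul0r.
(* A pattern position with [j <> l] left unreplaced has [j] outside [J], where [v j] vanishes. *)
rewrite eq0_notin_Jset ?mulr0 ?mul0r //; last by case: EP.
by apply: contraNN rb => jJ; rewrite /= in_setD1 jl jJ pij eqxx.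
Qed.

Lemma pd_new_dae_notin i a P : i \notin B -> ND P -> pd a (new_dae D f c d B v l (inl i)) P =
  pd a (f i \o @old_part _ _ D v l) P.
Proof. by rewrite /new_dae => /negbTE ->. Qed.

Lemma order_le_new_dae_notin i k b : i \notin B -> order_le D k b (f i) ->
  order_le ND (inl k : nI) b (new_dae D f c d B v l (inl i)).
Proof.
move=> iB hb m P NP km; rewrite pd_new_dae_notin // (pd_old _ _ _ (Some (k, m))) /=.
by apply: hb => //; case: NP.
Qed.

Lemma order_le_new_dae_notin_new i y b : i \notin B ->
  order_le ND (inr y : nI) b (new_dae D f c d B v l (inl i)).
Proof. by move=> iB m P NP km; rewrite pd_new_dae_notin // pd_old_new. Qed.

Lemma pd_g a y P : E P -> pd a (new_dae D f c d B v l (inr y)) P =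
  (- 1) * (Some (inr y, 0%N) == a)%:R + (Some (inl (val y), absz (d (val y) - cb)) == a)%:R +
  (- 1) * (Defs.ratio (val y) P * (Some (inl l, absz (d l - cb)) == a)%:R +
   P (Some (inl l, absz (d l - cb))) * pd a (@Defs.ratio _ _ D v l (val y)) P).
Proof.
have oE := open_regular_v; move=> EP.
have sc b : smooth E (fun Q : jet R nI => Q b) by exact: smooth_coord.
have s1 : smooth E (fun Q : jet R nI => - 1 * Q (Some (inr y, 0%N))).
  by apply: smooth_mul => //; exact: smooth_cst.
have sr := smooth_mul oE (smooth_ratio (val y)) (sc (Some (inl l, absz (d l - cb)))).
rewrite (_ : new_dae D f c d B v l (inr y) = fun Q => - 1 * Q (Some (inr y, 0%N)) +
  Q (Some (inl (val y), absz (d (val y) - cb))) +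
  - 1 * (Defs.ratio (val y) Q * Q (Some (inl l, absz (d l - cb))))); last first.
  by apply/funext => Q; rewrite /new_dae /xder !mulN1r.
rewrite (pd_add EP); first last.
- by apply: smooth_pdable; apply: smooth_mul => //; exact: smooth_cst.
- by apply: smooth_pdable; exact: smooth_add.
rewrite (pd_add EP); [|exact: smooth_pdable|exact: smooth_pdable].
rewrite !(pd_mul EP (@pdable_cst _ _ E a (- 1))); [|exact: smooth_pdable|exact: smooth_pdable].
rewrite (pd_mul EP); [|exact: smooth_pdable (smooth_ratio _)|exact: smooth_pdable].
by rewrite !pd_coord !pd_cst !mulr0 !addr0.
Qed.

Lemma order_le_g y k : order_le ND (inl k : nI) (d k - cb) (new_dae D f c d B v l (inr y)).
Proof.
move=> m P NP km; rewrite pd_g; last exact: new_domain_regular.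
rewrite (order_le_ratio (b := d k - cb)) //; last exact: new_domain_regular.
have yJ : val y \in J by have := valP y; rewrite in_setD1 => /andP[].
rewrite !mulr0 !addr0 ?add0r.
rewrite (_ : _ == _ = false) ?add0r; last first.
  by apply/eqP => -[ek em]; have kJ : k \in J; [by rewrite -ek|have := dge kJ; move: km em; rewrite ek; lia].
rewrite (_ : _ == _ = false) ?mulr0 //.
by apply/eqP => -[ek em]; move: km; rewrite -ek -em; have := dge lJ; lia.
Qed.

(** Both variables explicit in [g_j] have indices in [J], so [x_k] enters through the quotient
    alone. *)
Lemma order_lt_g y k : low k -> k \notin J ->
  order_le ND (inl k : nI) (d k - cb - 1) (new_dae D f c d B v l (inr y)).
Proof.
move=> lk kJ m P NP km; rewrite pd_g; last exact: new_domain_regular.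
rewrite (order_le_ratio (b := d k - cb - 1)) //; last first.
- exact: new_domain_regular.
- by apply: vlt; right.
- by apply: vlt; right.
have yJ : val y \in J by have := valP y; rewrite in_setD1 => /andP[].
rewrite !mulr0 !addr0 ?add0r.
rewrite (_ : _ == _ = false) ?add0r; last by apply/eqP => -[ek em]; rewrite -ek yJ in kJ.
rewrite (_ : _ == _ = false) ?mulr0 //.
by apply/eqP => -[ek em]; rewrite -ek lJ in kJ.
Qed.

Lemma order_le_g_new y z : order_le ND (inr z : nI) 0 (new_dae D f c d B v l (inr y)).
Proof.
move=> m P NP km; rewrite pd_g; last exact: new_domain_regular.
rewrite pd_ratio_new; last exact: new_domain_regular.
rewrite !mulr0 !addr0 mulr0 addr0 (_ : _ == _ = false) ?mulr0 //.
by apply/eqP => -[_ em]; move: km; rewrite -em.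
Qed.

End NewSystem.

(** * Signature matrices and transversals *)

Section Sigma.
Context {R : realType} {V : finType}.
Implicit Types (D : set (jet R V)) (u : expr R V) (x : V) (b : int).

Lemma occurs_le_sigma D x m u : occurs D x m u -> ((m%:Z%:~R)%:E <= sigma D x u)%E.
Proof. by move=> h; apply: ereal_sup_ubound; exists m. Qed.

Lemma sigma_order_le D x b u : (sigma D x u <= (b%:~R)%:E)%E -> order_le D x b u.
Proof.
move=> h m P DP bm; apply/not_notP => n.
have /occurs_le_sigma /le_trans /(_ h) : occurs D x m u by exists P.
by rewrite lee_fin ler_int leNgt bm.
Qed.

Lemma sigma_order_lt D x b u : (sigma D x u < (b%:~R)%:E)%E -> order_le D x (b - 1) u.
Proof.
move=> h m P DP bm; apply/not_notP => n.
have /occurs_le_sigma /le_lt_trans /(_ h) : occurs D x m u by exists P.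
by rewrite lte_fin ltr_int ltNge; apply/negP/negPn; lia.
Qed.

Lemma order_le_sigma D x b u : order_le D x b u -> (sigma D x u <= (b%:~R)%:E)%E.
Proof.
move=> h; apply: ge_ereal_sup => _ [m [P [DP n]] <-].
rewrite lee_fin -[m%:R]/(m%:Z%:~R) ler_int leNgt; apply/negP => bm.
by apply: n; exact: h.
Qed.

Lemma sigma_le_vec (I : finType) D x (w : I -> expr R V) i :
  (sigma D x (w i) <= sigma_vec D x w)%E.
Proof. exact: (@bigmax_sup _ _ _ _ i). Qed.

End Sigma.

(** * Values of signature matrices bounded by offsets *)

Section ValBounds.
Context {R : realType} {T : finType}.
Implicit Types (S : T -> T -> \bar R) (r k : T -> int).

Lemma sum_offsets (s : {perm T}) r k :
  \sum_i (k (s i) - r i) = \sum_i k i - \sum_i r i.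
Proof. by rewrite sumrB; congr (_ - _); rewrite [RHS](reindex_inj (@perm_inj _ s)). Qed.

Lemma Val_offsets S r k : valid_offsets S r k ->
  Val S = ((\sum_i k i - \sum_i r i)%:~R)%:E.
Proof.
move=> [_ _ [s <- hs]]; rewrite /transversal_value.
under eq_bigr do rewrite hs.
by rewrite sumEFin -(sum_offsets s) -raddf_sum.
Qed.

Lemma Val_lt_offsets S r k :
  (forall i j, S i j <= ((k j - r i)%:~R)%:E)%E ->
  (forall s : {perm T}, exists i, S i (s i) <= ((k (s i) - r i - 1)%:~R)%:E)%E ->
  (Val S < ((\sum_i k i - \sum_i r i)%:~R)%:E)%E.
Proof.
(* Orders are integers, so one strict position costs a whole unit; the bound lowered by that unit
   holds for all transversals and for the default [-oo] of the maximum. *)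
move=> hle hlt; apply: (@le_lt_trans _ _ ((\sum_i k i - \sum_i r i - 1)%:~R)%:E); last first.
  by rewrite lte_fin ltr_int; lia.
apply: bigmax_le => [|s _]; first exact: leNye.
have [i0 hi0] := hlt s.
apply: (@le_trans _ _ (\sum_i ((k (s i) - r i - (i == i0)%:Z)%:~R)%:E)%E).
  apply: lee_sum => i _; have [->|_] := eqVneq i i0; first exact: hi0.
  by rewrite subr0.
rewrite sumEFin lee_fin -(raddf_sum (intmul (1 : R))) ler_int sumrB sum_offsets.
rewrite [X in _ - X <= _](bigD1 i0) //= eqxx [\sum_(i | i != i0) _]big1 ?addr0 //.
by move=> i /negbTE ->.
Qed.

End ValBounds.

(** The match lists the positions where the order bound drops. If [s] met none, its inverse would
    inject the columns [C] into the rows [A], a smaller set; disjointness of [low] and [J] enters in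
    the size of [C]. *)
Lemma transversal_has_strict_position (I : finType) (low : pred I) (J : {set I}) (l : I) (lJ : l \in J)
    (lowJ : forall j, j \in J -> ~~ low j) (s : {perm (I + {j : I | j \in J :\ l})%type}) :
  exists i, (match i, s i with
  | inl i, inl k => ~~ low i && (low k || (k \in J))
  | inr _, inl k => low k
  | _, inr _ => false
  end : bool).
Proof.
apply/existsP; apply: contraT => /existsPn hs.
pose T := (I + {j : I | j \in J :\ l})%type.
pose L : {set I} := [set i | low i]%SET.
pose C : {set T} := (inl @: (L :|: J))%SET.
pose A : {set T} := (inl @: L :|: inr @: [set: {j : I | j \in J :\ l}])%SET.
have inl_inj : injective (@inl I {j : I | j \in J :\ l}) by move=> x y [].
have inr_inj : injective (@inr I {j : I | j \in J :\ l}) by move=> x y [].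
have cC : #|C| = (#|L| + #|J|)%N.
  rewrite card_imset // cardsU (_ : L :&: J = finset.set0) ?cards0 ?subn0 //.
  apply/setP => j; rewrite !inE; apply/negP => /andP[lj jJ].
  by have := lowJ j jJ; rewrite lj.
have cA : (#|A| <= #|L| + (#|J|.-1))%N.
  apply: leq_trans (leq_card_setU _ _) _.
  rewrite !card_imset // leq_add2l cardsT card_sig.
  by rewrite (cardsD1 l J) lJ /=; apply: eq_leq; apply: eq_card => j; rewrite !inE.
suff : (#|C| <= #|A|)%N.
  by rewrite leqNgt cC (leq_ltn_trans cA) // ltn_add2l prednK // (cardsD1 l J) lJ.
rewrite -(card_imset C (@perm_inj _ (s^-1)%g)); apply: subset_leq_card.
apply/fintype.subsetP => _ /imsetP[_ /imsetP[k kLJ ->] ->].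
have := permKV s (inl k); have := hs ((s^-1)%g (inl k)).
case: ((s^-1)%g (inl k)) => [i|y] /[swap] ->; rewrite finset.in_setU.
  rewrite negb_and negbK => h; rewrite imset_f // inE.
  move: h kLJ; rewrite !inE negb_or.
  by case: (low i) => //= /andP[/negbTE -> /negbTE ->].
by move=> _; rewrite (imset_f inr) ?orbT ?inE.
Qed.

(** * From the kernel of a diagonal block to rows of the full Jacobian *)

Section Block.
Context {R : realType} {p : nat} {N : 'I_p -> nat}.
Local Notation n := (\sum_k N k)%N.
Variables (D : set (jet R 'I_n)) (f : 'I_n -> expr R 'I_n) (c d : 'I_n -> int).
Variables (q : 'I_p) (w : 'I_(N q) -> expr R 'I_n).

Local Notation Bq := (@block p N q).

Lemma Rank_inj : injective (@tagnat.Rank p N q).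
Proof.
move=> a b /(congr1 val) /eqP; rewrite /= tagnat.eq_Rank eqxx /= => /eqP.
exact: val_inj.
Qed.

Lemma extend_Rank a : extend_by_zero w (tagnat.Rank q a) = w a.
Proof.
rewrite /extend_by_zero; case: pickP => [b /eqP /Rank_inj -> //|/(_ a)].
by rewrite eqxx.
Qed.

Lemma block_Rank i : i \in Bq -> exists a, i = tagnat.Rank q a.
Proof.
rewrite inE => /eqP iq; move: (tagnat.sig2K i); rewrite -/(blockOf i).
move: (tagnat.sig2 i); rewrite -/(blockOf i) iq => a <-.
by exists a.
Qed.

Lemma Rank_block a : tagnat.Rank q a \in Bq.
Proof. by rewrite inE /blockOf tagnat.Rank1K. Qed.

Lemma extend_off i : i \notin Bq -> extend_by_zero w i = fun=> 0.
Proof.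
move=> iq; rewrite /extend_by_zero; case: pickP => // a /eqP e.
by move: iq; rewrite -e Rank_block.
Qed.

Lemma extend_kernel : in_kernel D (diagonal_block D f c d q) w ->
  forall i P, i \in Bq -> D P ->
  \sum_j system_jacobian D f c d i j P * extend_by_zero w j P = 0.
Proof.
move=> hk i P /block_Rank[a ->] DP.
have /matrixP/(_ a ord0) := hk P DP; rewrite !mxE => {2}<-.
rewrite (bigID (mem (Bq))) /= [X in _ + X]big1 ?addr0; last first.
  by move=> j jq; rewrite extend_off // mulr0.
have -> : Bq = (@tagnat.Rank p N q @: [set: 'I_(N q)])%SET.
  apply/setP => j; apply/idP/imsetP => [/block_Rank[b ->]|[b _ ->]].
    by exists b.
  exact: Rank_block.
rewrite big_imset; last by move=> x y _ _; exact: Rank_inj.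
apply: eq_big => [b|b _]; first by rewrite inE.
by rewrite extend_Rank !mxE.
Qed.

End Block.

Theorem theorem3p2 (R : realType) (p : nat) (N : 'I_p -> nat)
    (D : set (jet R 'I_(\sum_k N k)))
    (f : 'I_(\sum_k N k) -> expr R 'I_(\sum_k N k))
    (c d : 'I_(\sum_k N k) -> int)
    (q : 'I_p) (vhat : 'I_(N q) -> expr R 'I_(\sum_k N k))
    (hD : jet_domain D)
    (hf : forall i, smooth_expr D (f i))
    (hwp : structurally_well_posed (signature D f))
    (hcd : valid_offsets (signature D f) c d)
    (hBTF : in_BTF (pattern (signature D f) c d))
    (hsing : identically_singular D (diagonal_block D f c d q))
    (hvs : forall a, smooth_expr D (vhat a))
    (hker : in_kernel D (diagonal_block D f c d q) vhat)
    (hv0 : exists a, nonzero_on D (vhat a)) :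
  let v := extend_by_zero vhat in
  let J := Jset D v in
  let cb := cbar D f c d (block q) v in
  forall
    (hlt : forall j, j \in J \/ (blockOf j < q)%N ->
       (sigma_vec D j v < ((d j - cb)%:~R)%:E)%E)
    (hle : forall j, j \in block q :\: J \/ (q < blockOf j)%N ->
       (sigma_vec D j v <= ((d j - cb)%:~R)%:E)%E)
    (hd : forall j, j \in J -> 0 <= d j - cb)
    (l : 'I_(\sum_k N k)) (hl : l \in J),
  (Val (signature (new_domain D f c d (block q) v l)
                  (new_dae D f c d (block q) v l))
   < Val (signature D f))%E.
Proof.
move=> v J cb hlt hle hd l hl.
have [oD _ _] := hD; have [_ hS _] := hcd; have [_ hB] := hBTF.
pose low (j : 'I_(\sum_k N k)) := (blockOf j < q)%N.
have smf i : smooth D (f i) by exact: smooth_exprW.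
have smv j : smooth D (v j).
  rewrite /v /extend_by_zero; case: pickP => [a _|_]; first exact: smooth_exprW.
  exact: smooth_cst.
have fle i j : order_le D j (d j - c i) (f i) by apply: sigma_order_le; exact: hS.
have flt i j : ~~ pattern (signature D f) c d i j -> order_le D j (d j - c i - 1) (f i).
  move=> /asboolPn ne; apply: sigma_order_lt; rewrite lt_neqAle hS andbT.
  by apply/eqP => e; apply: ne.
have vlt i j : j \in J \/ low j -> order_le D j (d j - cb - 1) (v i).
  by move=> /hlt h; apply: sigma_order_lt; apply: le_lt_trans (sigma_le_vec D j v i) h.
have JB j : j \in J -> j \in block q.
  apply: contraTT => jB; rewrite inE /v extend_off //; apply/asboolPn => -[P [_]].
  by apply.
(* Every index falls under one of the two order hypotheses, and the strict one implies the weak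
   one. *)
have vle i j : order_le D j (d j - cb) (v i).
  have [jJ|jJ] := boolP (j \in J).
    by move=> m P DP h; apply: (vlt i j (or_introl jJ)) => //; lia.
  case: (ltngtP (blockOf j) q) => [jq|jq|jq].
  - by move=> m P DP h; apply: (vlt i j (or_intror jq)) => //; lia.
  - apply: sigma_order_le; apply: le_trans (sigma_le_vec D j v i) (hle j _).
    by right.
  - apply: sigma_order_le; apply: le_trans (sigma_le_vec D j v i) (hle j _).
    by left; rewrite finset.in_setD jJ inE; apply/eqP/val_inj.
have ker := extend_kernel hker.
have lowB j : j \in block q -> ~~ low j by rewrite inE /low => /eqP ->; rewrite ltnn.
have npat i j : (blockOf j < blockOf i)%N -> ~~ pattern (signature D f) c d i j.
  by move=> h; apply/negP => /hB.
pose nI := newI D v l.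
pose c' (i : nI) := match i with inl i => c i | inr _ => cb end.
pose d' (i : nI) := match i with inl i => d i | inr _ => cb end.
(* [c'] and [d'] agree on the added indices, whose contributions therefore cancel. *)
have sum' (e e' : nI -> int) : (forall y, e (inr y) = e' (inr y)) ->
    \sum_i e i - \sum_i e' i = \sum_i e (inl i) - \sum_i e' (inl i).
  by move=> h; rewrite !big_sumType /= (eq_bigr _ (fun y _ => h y)) opprD addrACA subrr addr0.
rewrite (Val_offsets hcd) -(sum' d' c') //; apply: Val_lt_offsets => [i j|s].
  apply: order_le_sigma; case: i j => [i|y] [k|z]; rewrite /d' /c'.
  - have [iB|iB] := boolP (i \in block q); last by apply: order_le_new_dae_notin.
    by apply: order_le_new_dae_in.
  - have [iB|iB] := boolP (i \in block q); last by apply: order_le_new_dae_notin_new.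
    by apply: order_le_new_dae_in_new.
  - by apply: order_le_g.
  - by rewrite subrr; apply: order_le_g_new.
have [|i hi] := @transversal_has_strict_position _ low J l hl _ s.
  by move=> j /JB /lowB.
exists i; apply: order_le_sigma; case: i hi => [i|y]; case: (s _) => [k|z] // hi; rewrite /d' /c'.
- have {hi} /andP[il kJ] : ~~ low i && (low k || (k \in J)) := hi.
  have [iB|iB] := boolP (i \in block q).
    have [kJ'|kJ'] := boolP (k \in J).
      have [->|kl] := eqVneq k l; first exact: (order_lt_new_dae_l oD smf smv fle flt vle vlt hd hl ker iB).
      by apply: (order_lt_new_dae_in oD smf smv fle flt vlt hd hl iB); left.
    have kl : low k by move: kJ; rewrite (negbTE kJ') orbF.
    apply: (order_lt_new_dae_in oD smf smv fle flt vlt hd hl iB); right.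
    by split => //; apply: npat; move: iB kl; rewrite inE /low => /eqP ->.
  (* A row neither in the block nor before it comes after it, so columns of blocks up to [q] lie
     below the block diagonal. *)
  apply: order_le_new_dae_notin => //; apply: flt; apply: npat.
  have qi : (q < blockOf i)%N.
    rewrite ltn_neqAle leqNgt il andbT; apply: contra iB => /eqP e.
    by rewrite inE; apply/eqP/val_inj.
  case/orP: kJ => [kl|/JB]; first exact: ltn_trans kl qi.
  by rewrite inE => /eqP ->.
- have {hi} lk : low k := hi.
  apply: (order_lt_g oD smv vlt hl) => //.
  by apply/negP => /JB /lowB; rewrite lk.
Qed.
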